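(* Let $\nu\ge 2$ and $p\ge 3$ be integers, let $\omega\in\mathbb{R}^{\nu}$ be non-resonant, and let $c,d:\mathbb{Z}^{\nu}\to\mathbb{C}$. Assume that there exist $A>0$ and $0<\rho\le 1$ such that $$|c(n)|\le A e^{-\rho|n|},\qquad |d(n)|\le A e^{-\rho|n|},\qquad n\in\mathbb{Z}^{\nu}.$$ Let $$b_\rho:=(6\rho^{-1})^{\nu},\qquad M_\rho:=\max\{1,Ab_\rho\},\qquad B_\rho:=2M_\rho,\qquad L_{p,\rho}:=\frac{1}{p\,2^{p+3}M_\rho^{p-1}}.$$ Then, on $[0,L_{p,\rho}]$, the quasi-periodic Cauchy problem $$u_{tt}-u_{xx}-u_{xxtt}-(u^p)_{xx}=0,\qquad u(0,x)=\sum_{n\in\mathbb{Z}^{\nu}}c(n)e^{i\langle n,\omega\rangle x},\qquad u_t(0,x)=\sum_{n\in\mathbb{Z}^{\nu}}d(n)e^{i\langle n,\omega\rangle x},\qquad x\in\mathbb{R},$$ admits a classical spatially quasi-periodic solution $$u(t,x)=\sum_{n\in\mathbb{Z}^{\nu}}\widehat u(t,n)e^{i\langle n,\omega\rangle x}$$ satisfying $$|\widehat u(t,n)|\le B_\rho e^{-\frac{\rho}{2}|n|},\qquad 0\le t\le L_{p,\rho},\ n\in\mathbb{Z}^{\nu}.$$ Moreover, this solution is unique among all spatially quasi-periodic solutions of the Cauchy problem on $[0,L_{p,\rho}]$ (with the same frequency vector $\omega$) satisfying this exponential decay estimate.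
   Context: For $n=(n_1,\dots,n_\nu)\in\mathbb{Z}^\nu$, $|n|:=\sum_{j=1}^\nu|n_j|$ and $\langle n,\omega\rangle:=\sum_{j=1}^\nu n_j\omega_j$. The vector $\omega\in\mathbb{R}^\nu$ is non-resonant (rationally independent) if $\langle n,\omega\rangle=0$ with $n\in\mathbb{Z}^\nu$ implies $n=0$. A classical spatially quasi-periodic solution on $[0,L]$ with frequency vector $\omega$ is a function $u:[0,L]\times\mathbb{R}\to\mathbb{C}$ of the form $u(t,x)=\sum_{n\in\mathbb{Z}^\nu}\widehat u(t,n)e^{i\langle n,\omega\rangle x}$ for which the derivatives $u_t,u_{tt},u_{xx},u_{xxtt},(u^p)_{xx}$ exist as continuous functions on $[0,L]\times\mathbb{R}$ (one-sided in $t$ at the endpoints), the equation holds pointwise on $[0,L]\times\mathbb{R}$, and the two initial conditions hold pointwise. *)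

(* Defs.v *)
From HB Require Import structures.
From mathcomp Require Import all_boot all_order all_algebra finmap complex.
From mathcomp Require Import all_classical all_reals all_analysis.
Import Order.TTheory GRing.Theory Num.Theory numFieldNormedType.Exports.

Set Implicit Arguments.
Unset Strict Implicit.
Unset Printing Implicit Defensive.

Local Open Scope classical_set_scope.
Local Open Scope ring_scope.

(* MathComp-Analysis attaches the topology of a numFieldType K to K^o, hence
   the casts to R[i]^o below; on R[i] norms and balls are real elements r%:C of
   the complex field. *)

Definition expi (R : realType) (x : R) : R[i] := (cos x +i* sin x)%C.

(* Unconditional summation, along the finite subsets of the index set directed
   by inclusion; in R[i] this is the same as absolute summation. *)
Definition has_sum (R : realType) (I : choiceType) (a : I -> R[i]) (s : R[i]) :
  Prop :=
  forall eps : R, 0 < eps -> exists F0 : {fset I}, forall F : {fset I},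
    (F0 `<=` F)%fset -> `|\sum_(i <- F) a i - s| < (eps%:C)%C.

Definition inner (R : realType) (nu : nat) (n : 'rV[int]_nu) (omega : 'rV[R]_nu)
  : R := \sum_(j < nu) (n 0 j)%:~R * omega 0 j.

Definition norm1 (nu : nat) (n : 'rV[int]_nu) : nat :=
  (\sum_(j < nu) `|n ord0 j|)%N.

Definition nonresonant (R : realType) (nu : nat) (omega : 'rV[R]_nu) : Prop :=
  forall n : 'rV[int]_nu, inner n omega = 0 -> n = 0.

Definition qp_sum (R : realType) (nu : nat) (omega : 'rV[R]_nu)
    (c : 'rV[int]_nu -> R[i]) (x : R) (s : R[i]) : Prop :=
  has_sum (fun n => c n * expi (inner n omega * x)) s.

Definition exp_decay (R : realType) (nu : nat) (A rho : R)
    (c : 'rV[int]_nu -> R[i]) : Prop :=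
  forall n, `|c n| <= ((A * expR (- (rho * (norm1 n)%:R)))%:C)%C.

(* Derivative at a relative to D: one-sided at an endpoint of an interval D,
   two-sided for D = setT. *)
Definition has_deriv_within (R : realType) (D : set R) (f : R -> R[i]) (a : R)
    (l : R[i]) : Prop :=
  ((f s - f a) / ((s - a)%:C)%C : R[i]^o) @[s --> within D a^'] --> (l : R[i]^o).

Definition is_dt (R : realType) (L : R) (f g : R -> R -> R[i]) : Prop :=
  forall t x : R, 0 <= t <= L ->
    has_deriv_within `[0, L] (fun s => f s x) t (g t x).

Definition is_dx (R : realType) (L : R) (f g : R -> R -> R[i]) : Prop :=
  forall t x : R, 0 <= t <= L -> has_deriv_within setT (f t) x (g t x).

Definition strip_continuous (R : realType) (L : R) (f : R -> R -> R[i]) : Prop :=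
  {within [set z : R * R | 0 <= z.1 <= L],
     continuous (fun z : R * R => f z.1 z.2 : R[i]^o)}.

(* Functions of time are total but only their values for t in [0, L] matter.
   In u_xxtt the x-derivatives are taken first. *)
Definition classical_qp_solution (R : realType) (nu p : nat) (omega : 'rV[R]_nu)
    (c d : 'rV[int]_nu -> R[i]) (L : R) (u : R -> R -> R[i])
    (uhat : R -> 'rV[int]_nu -> R[i]) : Prop :=
  (forall t x : R, 0 <= t <= L -> qp_sum omega (uhat t) x (u t x)) /\
  exists u_t u_tt u_x u_xx u_xxt u_xxtt up_x up_xx : R -> R -> R[i],
    [/\ is_dt L u u_t /\ is_dt L u_t u_tt,
        is_dx L u u_x /\ is_dx L u_x u_xx,
        is_dt L u_xx u_xxt /\ is_dt L u_xxt u_xxtt &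
        is_dx L (fun t x => u t x ^+ p) up_x /\ is_dx L up_x up_xx] /\
    [/\ strip_continuous L u_t, strip_continuous L u_tt,
        strip_continuous L u_xx, strip_continuous L u_xxtt &
        strip_continuous L up_xx] /\
    [/\ forall t x : R, 0 <= t <= L ->
          u_tt t x - u_xx t x - u_xxtt t x - up_xx t x = 0,
        forall x : R, qp_sum omega c x (u 0 x) &
        forall x : R, qp_sum omega d x (u_t 0 x)].

Definition b_const (R : realType) (nu : nat) (rho : R) : R :=
  (6%:R * rho^-1) ^+ nu.

Definition M_const (R : realType) (nu : nat) (A rho : R) : R :=
  Num.max 1 (A * b_const nu rho).

Definition B_const (R : realType) (nu : nat) (A rho : R) : R :=
  2%:R * M_const nu A rho.

Definition L_const (R : realType) (nu p : nat) (A rho : R) : R :=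
  1 / (p%:R * 2%:R ^+ (p + 3) * M_const nu A rho ^+ (p - 1)).

(* Main.v *)
Require Import Defs.
From HB Require Import structures.
From mathcomp Require Import all_boot all_order all_algebra finmap complex.
From mathcomp Require Import all_classical all_reals all_analysis.
From mathcomp Require Import ring lra.
Import Order.TTheory GRing.Theory Num.Theory numFieldNormedType.Exports.

(** Write [k] for the frequency [inner n omega].  On Fourier coefficients the
    equation reads
      [uhat'' n = - lambda k * (uhat n + (p-fold convolution of uhat) n)]
    with [lambda k = k ^+ 2 / (1 + k ^+ 2)] in [0, 1): the term [u_xxtt] absorbs
    the two derivatives on the right, so this is an ordinary differential
    equation with a polynomial right-hand side in the weighted l^1 convolution
    algebra with weight [expR (rho / 2 * norm1 n)].  The initial data have norm
    at most [M] in this algebra, because [expR (- (rho / 2 * norm1 n))] sums to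
    at most [b_const nu rho] over the lattice ([sum_le_lattice]).

    Existence. The Taylor coefficients at [t = 0] are series of monomials in
    the numbers [c n] and [d n], and these monomials are indexed by finite
    trees: a leaf is one coefficient [c n] or [d n], a node joins one
    subtree (the linear term) or [p] subtrees (the power). Each tree
    contributes a single monomial mode [a * t ^+ e * expi (k * x)], so that
    [u] is a plain sum over trees, [u ^+ p] a sum over sequences of [p]
    trees, and the equation holds node by node ([sol_equation]);
    convolutions never appear. By [tree_sum_le] the sum of the weights of
    all trees is at most any [D] with [C + Q * (D + D ^+ p) <= D]; with [t]
    replaced by [2 * L] the choice of [L] makes [D = 2 * M] admissible. The
    factor 2 leaves room for derivatives in [t], the exponential weight
    leaves room for derivatives in [x], and all differentiations are
    termwise. Collecting the trees with a given total frequency gives [uhat]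
    with its decay.

    Uniqueness. The time derivatives of another solution [v] are not known
    to be quasi-periodic or even bounded in [x], so the argument stays in
    physical space. The difference [z = v - u] is bounded, has zero initial
    data and satisfies [(z - z_xx)_tt = g_xx] with [g = z + v ^+ p - u ^+
    p], hence [|g| <= C * |z|]. If [h] is the double time primitive of [g],
    then [z + h - (z + h)_xx = h], and the maximum principle gives [|z| <= 2
    * sup |h|] ([linear_estimate]). Bounds of the form [|z| <= S * expR (mu
    * t)] with [mu] large therefore improve by a factor 2, and iteration
    forces [z = 0] ([solution_unique]). *)

Set Implicit Arguments.
Unset Strict Implicit.
Unset Printing Implicit Defensive.

Local Open Scope classical_set_scope.
Local Open Scope ring_scope.
Import ComplexField.Normc.

(** * Sums over finite sets *)

(** All finite partial sums stay below [C]: for nonnegative families this is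
    summability with a bound on the sum, and it can be handled by finite
    combinatorics alone. *)
Definition sum_le (R : realType) (I : choiceType) (a : I -> R) (C : R) : Prop :=
  forall F : {fset I}, \sum_(i <- F) a i <= C.

Lemma preim_fset (I J : choiceType) (f : I -> J) (F : {fset J}) :
  injective f -> exists G : {fset I}, forall i, (i \in G) = (f i \in F).
Proof.
move=> f_inj.
pose g j : option I := if pselect (exists i, f i = j) is left h
  then Some (projT1 (cid h)) else None.
have gK i : g (f i) = Some i.
  rewrite /g; case: pselect => [h|[]]; last by exists i.
  by congr Some; apply: f_inj; exact: (projT2 (cid h)).
exists (seq_fset tt (pmap g F)) => i; rewrite seq_fsetE mem_pmap.
apply/mapP/idP => [[j jF]|fiF]; last by exists (f i).
rewrite /g; case: pselect => // h [->].
by case: (cid h) => i' /= ->.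
Qed.

(** A sum over [J] of a family vanishing off the image of [f] is a sum over [I].
    This transfer, for bounds and for sums, is how families on sums, products,
    sequences and trees are taken apart below. *)
Lemma sum_preim (V : zmodType) (I J : choiceType) (f : I -> J) (a : J -> V)
    (F : {fset J}) (G : {fset I}) : injective f ->
    (forall j, (forall i, f i <> j) -> a j = 0) ->
    (forall i, (i \in G) = (f i \in F)) ->
  \sum_(j <- F) a j = \sum_(i <- G) a (f i).
Proof.
move=> f_inj a0 GF.
have <- : \sum_(j <- (f @` G)%fset) a j = \sum_(i <- G) a (f i).
  by rewrite big_imfset //= => ? ? _ _; exact: f_inj.
apply/esym/big_fset_incl.
  by apply/fsubsetP => j /imfsetP[i /= iG ->]; rewrite -GF.
move=> j jF jG; apply: a0 => i fij; case/negP: jG.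
by apply/imfsetP; exists i => //=; rewrite GF fij.
Qed.

Section sum_le.
Variable R : realType.

Lemma sum_le_ge0 (I : choiceType) (a : I -> R) C : sum_le a C -> 0 <= C.
Proof. by move/(_ fset0); rewrite big_seq_fset0. Qed.

Lemma sum_leW (I : choiceType) (a b : I -> R) C :
  (forall i, a i <= b i) -> sum_le b C -> sum_le a C.
Proof. by move=> ab bC F; apply: le_trans (bC F); apply: ler_sum. Qed.

Lemma sum_le_trans (I : choiceType) (a : I -> R) C D :
  C <= D -> sum_le a C -> sum_le a D.
Proof. by move=> CD aC F; apply: le_trans CD. Qed.

Lemma sum_leD (I : choiceType) (a b : I -> R) C D :
  sum_le a C -> sum_le b D -> sum_le (fun i => a i + b i) (C + D).
Proof. by move=> aC bD F; rewrite big_split/= lerD. Qed.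

Lemma sum_leZ (I : choiceType) (a : I -> R) C k : 0 <= k ->
  sum_le a C -> sum_le (fun i => k * a i) (k * C).
Proof. by move=> k0 aC F; rewrite -mulr_sumr ler_wpM2l. Qed.

Lemma sum_le_image (I J : choiceType) (f : I -> J) (a : J -> R) C :
    injective f -> (forall j, (forall i, f i <> j) -> a j = 0) ->
  sum_le (fun i => a (f i)) C -> sum_le a C.
Proof.
move=> f_inj a0 aC F; have [G GF] := preim_fset F f_inj.
by rewrite (sum_preim f_inj a0 GF).
Qed.

Lemma sum_le_comp (I J : choiceType) (f : I -> J) (a : J -> R) C :
  injective f -> sum_le a C -> sum_le (fun i => a (f i)) C.
Proof.
move=> f_inj aC G.
have <- : \sum_(j <- (f @` G)%fset) a j = \sum_(i <- G) a (f i).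
  by rewrite big_imfset //= => ? ? _ _; exact: f_inj.
exact: aC.
Qed.

Lemma sum_le_pair (I J : choiceType) (a : I -> R) (b : J -> R) C D :
    (forall i, 0 <= a i) -> (forall j, 0 <= b j) ->
  sum_le a C -> sum_le b D -> sum_le (fun z : I * J => a z.1 * b z.2) (C * D).
Proof.
move=> a0 b0 aC bD F.
rewrite (@partition_big_imfset _ _ _ _ _ fst) /=.
have D0 := sum_le_ge0 bD.
apply: (@le_trans _ _ (\sum_(i <- [fset z.1 | z in F]%fset) a i * D));
  last first.
  by rewrite -mulr_suml ler_wpM2r.
apply: ler_sum => i _.
rewrite (eq_bigr (fun z : I * J => a i * b z.2)); last by move=> z /eqP ->.
rewrite -mulr_sumr ler_wpM2l // big_fset_condE.
set Fi := [fset z in F | z.1 == i]%fset.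
have <- : \sum_(j <- (snd @` Fi)%fset) b j = \sum_(z <- Fi) b z.2.
  rewrite big_imfset //= => -[i1 j1] [i2 j2].
  by rewrite !inE /= => /andP[_ /eqP->] /andP[_ /eqP->] ->.
exact: bD.
Qed.

Lemma sum_le1 (I : choiceType) (a : I -> R) i0 :
  0 <= a i0 -> (forall i, i != i0 -> a i = 0) -> sum_le a (a i0).
Proof.
move=> a00 a0 F; have [iF|iF] := boolP (i0 \in F).
  rewrite (big_fsetD1 i0) //= big_seq big1 ?addr0 // => i.
  by rewrite !inE => /andP[/a0].
rewrite big_seq big1 // => i iF'; apply: a0; apply: contraNneq iF.
by move=> <-.
Qed.

(** Multinomial expansion of [C ^+ m]. *)
Lemma sum_le_seq (I : choiceType) (a : I -> R) C m :
    (forall i, 0 <= a i) -> sum_le a C ->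
  sum_le (fun s : seq I => if size s == m then \prod_(i <- s) a i else 0)
         (C ^+ m).
Proof.
move=> a0 aC; elim: m => [|m IHm].
  have := @sum_le1 (seq I)
    (fun s : seq I => if size s == 0%N then \prod_(i <- s) a i else 0) [::].
  by rewrite /= big_nil expr0; apply=> // -[].
apply: (@sum_le_image (I * seq I)%type _ (fun z => z.1 :: z.2)).
- by move=> [i1 s1] [i2 s2] /= [-> ->].
- by case=> // i s /(_ (i, s)).
rewrite exprS; apply: sum_leW (sum_le_pair a0 _ aC IHm).
  by move=> [i s] /=; rewrite eqSS big_cons; case: ifP; rewrite ?mulr0.
by move=> s; case: ifP => // _; apply: prodr_ge0.
Qed.

End sum_le.

(** * Unconditional sums of complex families *)

Section has_sum.
Variable R : realType.

Lemma normc_opp (z : R[i]) : normc (- z) = normc z. Proof. exact: normcN. Qed.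

Lemma normc_ge0 (z : R[i]) : 0 <= normc z.
Proof. by case: z => x y /=; exact: sqrtr_ge0. Qed.

Lemma normcD (z w : R[i]) : normc (z + w) <= normc z + normc w.
Proof. exact: le_normcD. Qed.

Lemma normcB (z w : R[i]) : normc (z - w) <= normc z + normc w.
Proof. by rewrite -(normc_opp w); exact: normcD. Qed.

Lemma normc_distC (z w : R[i]) : normc (z - w) = normc (w - z).
Proof. by rewrite -normc_opp opprB. Qed.

Lemma normc_real (x : R) : normc (x%:C)%C = `|x|.
Proof. by rewrite /= expr0n/= addr0 sqrtr_sqr. Qed.

Lemma normcX (z : R[i]) n : normc (z ^+ n) = normc z ^+ n.
Proof. by elim: n => [|n IH]; rewrite ?expr0 ?normc1 // !exprS normcM IH. Qed.

Lemma normc_sum (I : Type) (r : seq I) (a : I -> R[i]) :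
  normc (\sum_(i <- r) a i) <= \sum_(i <- r) normc (a i).
Proof.
elim: r => [|i r IH]; first by rewrite !big_nil normc0.
by rewrite !big_cons; apply: le_trans (normcD _ _) _; rewrite lerD2l.
Qed.

Lemma normc_prod (I : Type) (r : seq I) (a : I -> R[i]) :
  normc (\prod_(i <- r) a i) = \prod_(i <- r) normc (a i).
Proof.
elim: r => [|i r IH]; first by rewrite !big_nil normc1.
by rewrite !big_cons normcM IH.
Qed.

Lemma Re_le_normc (z : R[i]) : `|complex.Re z| <= normc z.
Proof. by rewrite -lecR; exact: normc_ge_Re. Qed.

Lemma Im_le_normc (z : R[i]) : `|complex.Im z| <= normc z.
Proof. by case: z => x y /=;
  rewrite -sqrtr_sqr ler_wsqrtr // lerDr sqr_ge0. Qed.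

Lemma normc_le_ReIm (z : R[i]) : normc z <= `|complex.Re z| + `|complex.Im z|.
Proof.
rewrite [in leLHS](complexE z); apply: le_trans (normcD _ _) _.
by rewrite normcM !normc_real /= expr0n expr1n add0r sqrtr1 mul1r.
Qed.

Lemma has_sumP (I : choiceType) (a : I -> R[i]) s :
  has_sum a s <-> forall eps : R, 0 < eps -> exists F0 : {fset I},
    forall F : {fset I}, (F0 `<=` F)%fset ->
      normc (\sum_(i <- F) a i - s) < eps.
Proof.
split=> h e /h [F0 hF]; exists F0 => F /hF.
  by move=> h1; rewrite -ltcR.
by rewrite -ltcR.
Qed.

Lemma eq_has_sum (I : choiceType) (a b : I -> R[i]) s :
  a =1 b -> has_sum a s -> has_sum b s.
Proof. by move=> /funext ->. Qed.

Lemma has_sum_le (I : choiceType) (a : I -> R[i]) s C :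
  has_sum a s -> (forall F : {fset I}, normc (\sum_(i <- F) a i) <= C) ->
  normc s <= C.
Proof.
move=> /has_sumP as_ aC; apply/ler_addgt0Pr => e e0.
have [F0 /(_ F0 (fsubset_refl _)) /ltW h] := as_ _ e0.
have -> : s = \sum_(i <- F0) a i - (\sum_(i <- F0) a i - s) by ring.
by apply: le_trans (normcB _ _) _; rewrite lerD.
Qed.

Lemma has_sum_normc (I : choiceType) (a : I -> R[i]) s C :
  has_sum a s -> sum_le (fun i => normc (a i)) C -> normc s <= C.
Proof.
move=> as_ aC; apply: has_sum_le as_ _ => F.
exact: le_trans (normc_sum _ _) _.
Qed.

Lemma has_sumD (I : choiceType) (a b : I -> R[i]) s t :
  has_sum a s -> has_sum b t -> has_sum (fun i => a i + b i) (s + t).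
Proof.
move=> /has_sumP as_ /has_sumP bt; apply/has_sumP => e e0.
have e20 : 0 < e / 2 by lra.
have [F0 hF] := as_ _ e20; have [G0 hG] := bt _ e20.
exists (F0 `|` G0)%fset => F /fsubUsetP[F0F G0F]; rewrite big_split /=.
have -> : \sum_(i <- F) a i + \sum_(i <- F) b i - (s + t) =
  (\sum_(i <- F) a i - s) + (\sum_(i <- F) b i - t) by ring.
apply: le_lt_trans (normcD _ _) _.
by move: (hF _ F0F) (hG _ G0F); lra.
Qed.

Lemma has_sumZ (I : choiceType) (a : I -> R[i]) s k :
  has_sum a s -> has_sum (fun i => k * a i) (k * s).
Proof.
move=> /has_sumP as_; apply/has_sumP => e e0.
have k0 : 0 < normc k + 1 by have := normc_ge0 k; lra.
have [F0 hF] := as_ _ (divr_gt0 e0 k0).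
exists F0 => F /hF; rewrite -mulr_sumr -mulrBr normcM ltr_pdivlMr // => h.
apply: le_lt_trans h; rewrite mulrC ler_wpM2l ?normc_ge0 //; lra.
Qed.

Lemma has_sumN (I : choiceType) (a : I -> R[i]) s :
  has_sum a s -> has_sum (fun i => - a i) (- s).
Proof.
move=> /(has_sumZ (-1)); rewrite mulN1r.
by under eq_fun do rewrite mulN1r.
Qed.

Lemma has_sumB (I : choiceType) (a b : I -> R[i]) s t :
  has_sum a s -> has_sum b t -> has_sum (fun i => a i - b i) (s - t).
Proof. by move=> as_ /has_sumN; exact: has_sumD. Qed.

Lemma has_sum0 (I : choiceType) : has_sum (fun _ : I => 0 : R[i]) 0.
Proof.
apply/has_sumP => e e0; exists fset0 => F _.
by rewrite big1 // subrr normc0.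
Qed.

Lemma has_sum_unique (I : choiceType) (a : I -> R[i]) s t :
  has_sum a s -> has_sum a t -> s = t.
Proof.
move=> as_ at_; apply/eqP; rewrite -subr_eq0; apply/eqP/eq0_normc/eqP.
rewrite eq_le normc_ge0 andbT; apply: has_sum_le (has_sumB as_ at_) _ => F.
by rewrite big1 ?normc0 // => i _; rewrite subrr.
Qed.

Lemma has_sum_bigsum (I : choiceType) (J : Type) (r : seq J)
    (a : J -> I -> R[i]) (s : J -> R[i]) :
  (forall j, has_sum (a j) (s j)) ->
  has_sum (fun i => \sum_(j <- r) a j i) (\sum_(j <- r) s j).
Proof.
move=> as_; elim: r => [|j r IH].
  rewrite big_nil; under eq_fun do rewrite big_nil; exact: has_sum0.
rewrite big_cons; under eq_fun do rewrite big_cons; exact: has_sumD.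
Qed.

Lemma has_sum_image (I J : choiceType) (f : I -> J) (a : J -> R[i]) s :
    injective f -> (forall j, (forall i, f i <> j) -> a j = 0) ->
  has_sum (fun i => a (f i)) s -> has_sum a s.
Proof.
move=> f_inj a0 /has_sumP as_; apply/has_sumP => e /as_[G0 hG].
exists (f @` G0)%fset => F /fsubsetP G0F; have [G GF] := preim_fset F f_inj.
rewrite (sum_preim f_inj a0 GF); apply: hG.
by apply/fsubsetP => i iG0; rewrite GF; apply: G0F; apply/imfsetP; exists i.
Qed.

Lemma has_sum_real_ge0 (I : choiceType) (a : I -> R) C :
    (forall i, 0 <= a i) -> sum_le a C ->
  exists s, has_sum (fun i => ((a i)%:C)%C) s.
Proof.
move=> a0 aC; pose P := [set x | exists F : {fset I}, x = \sum_(i <- F) a i].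
have hP : has_sup P.
  split; first by exists (\sum_(i <- fset0) a i), fset0.
  by exists C => x [F ->].
exists ((sup P)%:C)%C; apply/has_sumP => e e0.
have [x [F0 ->] hx] := sup_adherent e0 hP.
exists F0 => F F0F; rewrite -rmorph_sum -rmorphB normc_real.
have h1 : \sum_(i <- F) a i <= sup P.
  by apply: sup_upper_bound => //; exists F.
have h2 : \sum_(i <- F0) a i <= \sum_(i <- F) a i.
  rewrite [leRHS](big_fsetID _ (mem F0)) /=.
  rewrite (_ : [fset x in F | x \in F0]%fset = F0) ?lerDl ?sumr_ge0 //.
  apply/fsetP => i; rewrite !inE /= andb_idl //.
  by move: i; apply/fsubsetP.
by rewrite ler0_norm; lra.
Qed.

(** The supremum of the partial sums gives nonnegative families their sum; real
    and imaginary parts become nonnegative after adding [normc (a i)]. *)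
Lemma abs_has_sum (I : choiceType) (a : I -> R[i]) C :
  sum_le (fun i => normc (a i)) C -> exists s, has_sum a s.
Proof.
move=> aC.
have [s0 hs0] := has_sum_real_ge0 (fun i => normc_ge0 (a i)) aC.
have shift (b : I -> R) : (forall i, `|b i| <= normc (a i)) ->
    exists s, has_sum (fun i => ((b i)%:C)%C) s.
  move=> ba; have [||s hs] := @has_sum_real_ge0 I
      (fun i => b i + normc (a i)) (C + C).
  - by move=> i; have := ba i; rewrite ler_norml; lra.
  - apply: sum_leW (sum_leD aC aC) => i /=.
    by rewrite lerD2r; apply: le_trans (ba i); apply: ler_norm.
  exists (s - s0); have := has_sumB hs hs0; congr has_sum.
  by apply/funext => i; rewrite -rmorphB /=; congr (_%:C)%C; ring.
have [s1 hs1] := shift _ (fun i => Re_le_normc (a i)).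
have [s2 hs2] := shift _ (fun i => Im_le_normc (a i)).
exists (s1 + 'i%C * s2); have := has_sumD hs1 (has_sumZ 'i%C hs2).
by under eq_fun do rewrite -complexE.
Qed.

(** Associativity: if the sums over the fibers of [N] exist, then the total sum
    is the sum of the fiber sums.  For finite [G] the family cut off outside the
    fibers over [G] sums to [\sum_(j <- G) b j], and once [G] covers the indices
    that matter for [s], what was cut off has only small partial sums. *)
Lemma has_sum_fiber (I J : choiceType) (N : I -> J) (a : I -> R[i])
    (b : J -> R[i]) s :
    (forall j, has_sum (fun i => if N i == j then a i else 0) (b j)) ->
  has_sum a s -> has_sum b s.
Proof.
move=> ab as_; apply/has_sumP => e e0.
have e30 : 0 < e / 3 by lra.
have /has_sumP/(_ _ e30)[F0 hF0] := as_.
exists (N @` F0)%fset => G /fsubsetP F0G.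
have := has_sumB as_ (has_sum_bigsum G ab).
set a' := (X in has_sum X _) => a's.
have a'E i : a' i = if N i \in G then 0 else a i.
  rewrite /a'; case: ifPn => NiG; last first.
    rewrite big_seq big1 ?subr0 // => j jG.
    by rewrite ifN //; apply: contraNneq NiG => ->.
  rewrite (big_fsetD1 (N i)) //= eqxx big_seq big1 ?addr0 ?subrr // => j.
  by rewrite !inE eq_sym => /andP[/negbTE ->].
rewrite normc_distC; apply: (@le_lt_trans _ _ (e / 3 + e / 3)); last by lra.
apply: has_sum_le a's _ => F.
rewrite (eq_bigr _ (fun i _ => a'E i)).
pose F1 := [fset i in F | N i \notin G]%fset.
have -> : \sum_(i <- F) (if N i \in G then 0 else a i) = \sum_(i <- F1) a i.
  rewrite /F1 (big_fsetID _ [pred i | N i \in G]) /= [X in X + _]big1_seq.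
    rewrite add0r; apply: eq_big_seq => i; rewrite !inE => /andP[_].
    by move/negbTE => ->.
  by move=> i; rewrite !inE /= => /andP[_ ->].
have F01 : [fset i in (F0 `|` F1) | i \in F0]%fset = F0.
  apply/fsetP => i; rewrite !inE /=.
  by case: (i \in F0); rewrite ?andbT ?andbF.
have F10 : [fset i in (F0 `|` F1) | i \notin F0]%fset = F1.
  apply/fsetP => i; rewrite !inE /=.
  have [iF0|iF0] := boolP (i \in F0); last by rewrite /= andbT.
  rewrite /= ?andbF; symmetry; apply/negbTE; rewrite negb_and negbK.
  by apply/orP; right; apply: F0G; apply/imfsetP; exists i.
have E : \sum_(i <- (F0 `|` F1)%fset) a i
    = \sum_(i <- F0) a i + \sum_(i <- F1) a i.
  by rewrite (big_fsetID _ (mem F0)) /= F01 F10.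
have -> : \sum_(i <- F1) a i = (\sum_(i <- (F0 `|` F1)%fset) a i - s)
  - (\sum_(i <- F0) a i - s) by rewrite E; ring.
apply: le_trans (normcB _ _) _; apply: lerD; apply/ltW/hF0 => //.
exact: fsubsetUl.
Qed.

(** The product family is absolutely summable, and grouping it by its first
  index
    leaves the sum of [a i * t]. *)
Lemma has_sum_pair (I J : choiceType) (a : I -> R[i]) (b : J -> R[i]) s t C D :
    sum_le (fun i => normc (a i)) C -> sum_le (fun j => normc (b j)) D ->
    has_sum a s -> has_sum b t ->
  has_sum (fun z : I * J => a z.1 * b z.2) (s * t).
Proof.
move=> aC bD as_ bt.
have [|w hw] := @abs_has_sum _ (fun z : I * J => a z.1 * b z.2) (C * D).
  under eq_fun do rewrite normcM.
  by apply: (sum_le_pair _ _ aC bD) => ?; exact: normc_ge0.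
have : has_sum (fun i => a i * t) w.
  apply: (@has_sum_fiber _ _ fst _ _ _ _ hw) => i.
  apply: (@has_sum_image J _ (fun j => (i, j))).
  - by move=> j1 j2 [].
  - by move=> [i' j'] /=; case: eqP => // -> /(_ j').
  by rewrite /= eqxx; exact: has_sumZ.
under eq_fun do rewrite mulrC; move=> h.
by rewrite mulrC -(has_sum_unique h (has_sumZ t as_)).
Qed.

Lemma has_sum1 (I : choiceType) (a : I -> R[i]) i0 :
  (forall i, i != i0 -> a i = 0) -> has_sum a (a i0).
Proof.
move=> a0; apply/has_sumP => e e0; exists [fset i0]%fset => F.
rewrite fsub1set => iF; rewrite (big_fsetD1 i0) //= big_seq big1.
  by rewrite addr0 subrr normc0.
by move=> i; rewrite !inE => /andP[/a0].
Qed.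

Lemma has_sum_seq (I : choiceType) (a : I -> R[i]) s C m :
    sum_le (fun i => normc (a i)) C -> has_sum a s ->
  has_sum (fun l : seq I => if size l == m then \prod_(i <- l) a i else 0)
          (s ^+ m).
Proof.
move=> aC as_; elim: m => [|m IHm].
  have := @has_sum1 (seq I)
    (fun l : seq I => if size l == 0%N then \prod_(i <- l) a i else 0) [::].
  by rewrite /= big_nil expr0; apply=> -[].
apply: (@has_sum_image (I * seq I)%type _ (fun z => z.1 :: z.2)).
- by move=> [i1 s1] [i2 s2] /= [-> ->].
- by case=> // i l /(_ (i, l)).
have bD : sum_le (fun l : seq I => normc
    (if size l == m then \prod_(i <- l) a i else 0)) (C ^+ m).
  apply: sum_leW (sum_le_seq m (fun i => normc_ge0 (a i)) aC) => l.
  by case: ifP => // _; rewrite ?normc_prod ?normc0.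
rewrite exprS; have := has_sum_pair aC bD as_ IHm.
congr has_sum; apply/funext => -[i l] /=.
by rewrite eqSS big_cons; case: ifP; rewrite ?mulr0.
Qed.

End has_sum.

(** * Derivatives and continuity in epsilon-delta form *)

Lemma has_deriv_withinP (R : realType) (D : set R) (f : R -> R[i]) (a : R)
    (l : R[i]) : has_deriv_within D f a l <->
  forall e : R, 0 < e -> exists2 d : R, 0 < d & forall s, D s -> `|s - a| < d ->
    normc (f s - f a - l * ((s - a)%:C)%C) <= e * `|s - a|.
Proof.
have quot s : s != a ->
  f s - f a - l * ((s - a)%:C)%C
  = ((f s - f a) / ((s - a)%:C)%C - l) * ((s - a)%:C)%C.
  move=> sa; rewrite mulrBl divfK //; apply/eqP => /complexI /eqP.
  by rewrite subr_eq0; exact/negP.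
split.
  move=> /(@cvgrPdist_lt _ R[i]^o) fl e e0.
  have eC : 0 < (e%:C)%C :> R[i] by rewrite ltcR.
  have := fl _ eC; rewrite !near_withinE => /nbhs_ballP[d /= d0 h].
  exists d => // s Ds sd; have [->|sa] := eqVneq s a.
    by rewrite !subrr mulr0 subrr normc0 normr0 mulr0.
  rewrite quot // normcM normc_real ler_wpM2r // normc_distC.
  have := h s; rewrite /ball /= distrC => /(_ sd sa Ds) hs.
  by rewrite -lecR; exact: ltW.
move=> h; apply/(@cvgrPdist_lt _ R[i]^o) => e e0.
have [e' eE] : exists e', e = (e'%:C)%C.
  by apply/complex_realP; exact: gtr0_real.
move: e0; rewrite {}eE ltcR => e0.
have e20 : 0 < e' / 2 by lra.
have [d d0 hd] := h _ e20; rewrite !near_withinE; apply/nbhs_ballP.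
exists d => // s; rewrite /ball /= distrC => sd sa Ds.
have sa0 : 0 < `|s - a| by rewrite normr_gt0 subr_eq0.
have := hd s Ds sd; rewrite quot // normcM normc_real ler_pM2r // => hs.
have : normc (l - (f s - f a) / ((s - a)%:C)%C) < e'.
  by rewrite normc_distC; lra.
by rewrite -ltcR.
Qed.

Lemma strip_continuousP (R : realType) (L : R) (f : R -> R -> R[i]) :
  strip_continuous L f <-> forall t x e : R, 0 <= t <= L -> 0 < e ->
    exists2 d : R, 0 < d & forall t' x', 0 <= t' <= L -> `|t' - t| < d ->
      `|x' - x| < d -> normc (f t' x' - f t x) < e.
Proof.
rewrite /strip_continuous.
split.
  move/subspace_continuousP => fc t x e tL e0.
  have /(@cvgrPdist_lt _ R[i]^o) := fc (t, x) tL.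
  have eC : 0 < (e%:C)%C :> R[i] by rewrite ltcR.
  move=> /(_ _ eC); rewrite near_withinE => /nbhs_ballP[d /= d0 h].
  exists d => // t' x' t'L t'd x'd; rewrite normc_distC -ltcR.
  by apply: (h (t', x')) => //; split; rewrite /ball /= distrC.
move=> h; apply/subspace_continuousP => -[t x] tL.
apply/(@cvgrPdist_lt _ R[i]^o) => e e0.
have [e' eE] : exists e', e = (e'%:C)%C.
  by apply/complex_realP; exact: gtr0_real.
move: e0; rewrite {}eE ltcR => e0.
have [d d0 hd] := h _ x _ tL e0; rewrite near_withinE; apply/nbhs_ballP.
exists d => // -[t' x'] [/=]; rewrite /ball /= => t't x'x t'L.
have := hd t' x' t'L; rewrite !(distrC _ t) !(distrC _ x) => /(_ t't x'x).
by rewrite normc_distC -ltcR.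
Qed.

(** * Real derivatives relative to a set, and comparison *)

Section real_derivatives.
Variable R : realType.
Implicit Types (D : set R) (f g : R -> R).

(** The quotient-free form of differentiability makes the base point harmless,
    so that linearity is immediate. *)
Definition rderiv D f (a l : R) : Prop :=
  forall e : R, 0 < e -> exists2 d : R, 0 < d & forall s, D s -> `|s - a| < d ->
    `|f s - f a - l * (s - a)| <= e * `|s - a|.

Lemma rderivD D f g a l m :
  rderiv D f a l -> rderiv D g a m -> rderiv D (fun s => f s + g s) a (l + m).
Proof.
move=> hf hg e e0; have e20 : 0 < e / 2 by lra.
have [d1 d10 h1] := hf _ e20; have [d2 d20 h2] := hg _ e20.
exists (Num.min d1 d2) => [|s Ds]; first by rewrite lt_min d10.
rewrite lt_min => /andP[/(h1 _ Ds) k1 /(h2 _ Ds) k2].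
have -> : f s + g s - (f a + g a) - (l + m) * (s - a) =
  (f s - f a - l * (s - a)) + (g s - g a - m * (s - a)) by ring.
by apply: le_trans (ler_normD _ _) _; lra.
Qed.

Lemma rderivZ D f a l k : rderiv D f a l -> rderiv D (fun s =>
  k * f s) a (k * l).
Proof.
move=> hf e e0; have k0 : 0 < `|k| + 1 by have := normr_ge0 k; lra.
have [d d0 h] := hf _ (divr_gt0 e0 k0); exists d => // s Ds sd.
have -> : k * f s - k * f a - k * l * (s - a) = k * (f s - f a - l * (s - a)).
  by ring.
rewrite normrM; apply: (@le_trans _ _ (`|k| * (e / (`|k| + 1) * `|s - a|))).
  by rewrite ler_wpM2l // h.
rewrite mulrA ler_wpM2r // mulrCA ler_piMr ?(ltW e0) // ler_pdivrMr //.
by rewrite mul1r; lra.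
Qed.

Lemma rderivN D f a l : rderiv D f a l -> rderiv D (fun s => - f s) a (- l).
Proof.
move=> /(rderivZ (-1)); rewrite mulN1r.
by under eq_fun do rewrite mulN1r.
Qed.

Lemma rderivB D f g a l m :
  rderiv D f a l -> rderiv D g a m -> rderiv D (fun s => f s - g s) a (l - m).
Proof. by move=> hf /rderivN; exact: rderivD. Qed.

Lemma is_derive_rderiv D f (a l : R) : is_derive a 1 f l -> rderiv D f a l.
Proof.
move=> [fd fl] e e0.
have : h^-1 *: (f (h *: 1 + a) - f a) @[h --> 0^'] --> l.
  by rewrite -fl; exact: fd.
move=> /(@cvgrPdist_le _ R^o) /(_ _ e0).
rewrite near_withinE => /nbhs_ballP[d /= d0 h].
exists d => // s _ sd; have [->|sa] := eqVneq s a.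
  by rewrite !subrr mulr0 subrr normr0 mulr0.
have sa0 : s - a != 0 by rewrite subr_eq0.
have := h (s - a); rewrite /ball /= sub0r normrN => /(_ sd sa0).
rewrite /GRing.scale /= mulr1 subrK => hs.
have -> : f s - f a - l * (s - a) = - ((l - (s - a)^-1 * (f s - f a)) * (s -
  a)).
  by field.
by rewrite normrN normrM ler_wpM2r.
Qed.

Lemma rderiv_is_derive f (T a l : R) : 0 < a < T ->
  rderiv `[0, T] f a l -> is_derive a 1 f l.
Proof.
move=> /andP[a0 aT] hf.
have H : h^-1 *: (f (h *: 1 + a) - f a) @[h --> 0^'] --> l.
  apply/(@cvgrPdist_le _ R^o) => e e0; have [d d0 h] := hf _ e0.
  rewrite near_withinE; apply/nbhs_ballP.
  exists (Num.min d (Num.min a (T - a))).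
    by rewrite /= !lt_min d0 a0 subr_gt0.
  move=> k; rewrite /ball /= sub0r normrN !lt_min => /and3P[kd ka kT] k0.
  have kaD : (k + a) \in `[0, T].
    rewrite in_itv /=; move: ka kT; rewrite !ltr_norml; lra.
  have := h (k + a) kaD; rewrite addrK => /(_ kd) hk.
  have k0' : 0 < `|k| by rewrite normr_gt0.
  rewrite /GRing.scale /= mulr1 -(ler_pM2r k0') -normrM.
  apply: le_trans hk; rewrite -normrN le_eqVlt; apply/orP; left; apply/eqP.
  by congr `|_|; field.
by split; [apply/cvg_ex; exists l | exact: cvg_lim H].
Qed.

Lemma rderiv_continuous D f a l : rderiv D f a l ->
  forall e : R, 0 < e -> exists2 d : R, 0 < d & forall s, D s -> `|s - a| < d ->
    `|f s - f a| < e.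
Proof.
move=> /(_ 1 ltr01) [d d0 h] e e0; have l0 := normr_ge0 l.
have l1 : 0 < `|l| + 1 by lra.
exists (Num.min d (e / (`|l| + 1))) => [|s Ds].
  by rewrite lt_min d0 divr_gt0.
rewrite lt_min ltr_pdivlMr // mulrDr mulr1 => /andP[/(h _ Ds) k1 k2].
have -> : f s - f a = (f s - f a - l * (s - a)) + l * (s - a) by ring.
apply: le_lt_trans (ler_normD _ _) _; rewrite normrM.
by apply: le_lt_trans k2; rewrite mul1r mulrC in k1 *; lra.
Qed.

Lemma rderiv_within_continuous (T : R) f (f' : R -> R) :
  (forall t, 0 <= t <= T -> rderiv `[0, T] f t (f' t)) ->
  {within `[0, T], continuous f}.
Proof.
move=> hf; apply/subspace_continuousP => t; rewrite /= in_itv /= => tT.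
apply/(@cvgrPdist_lt _ R^o) => e e0.
have [d d0 h] := rderiv_continuous (hf _ tT) e0.
rewrite near_withinE; apply/nbhs_ballP; exists d => // s.
rewrite /ball /= distrC => sd Ds; rewrite distrC; exact: h.
Qed.

Lemma rderiv_ge0 (T : R) f (f' : R -> R) : 0 <= T ->
    (forall t, 0 <= t <= T -> rderiv `[0, T] f t (f' t)) ->
    (forall t, 0 <= t <= T -> 0 <= f' t) ->
  f 0 <= f T.
Proof.
move=> T0 hf f'0.
have itvW t : t \in `]0, T[ -> 0 <= t <= T.
  by rewrite in_itv /= => /andP[/ltW -> /ltW ->].
have hd t : t \in `]0, T[ -> is_derive t 1 f (f' t).
  by move=> tT; apply: (@rderiv_is_derive _ T);
    [rewrite in_itv in tT|exact/hf/itvW].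
apply: (@ger0_derive1_le_cc _ f 0 T); rewrite ?in_itv /= ?lexx ?T0 //.
- by move=> t /hd [].
- by move=> t tT; have [_ ft] := hd _ tT; rewrite derive1E ft; exact/f'0/itvW.
- exact: rderiv_within_continuous hf.
Qed.

(** The comparison principle behind all estimates in time: it bounds a function
    by another one through their second derivatives, without integrals. *)
Lemma rderiv2_ge0 (T : R) f (f' f'' : R -> R) : 0 <= T ->
    (forall t, 0 <= t <= T -> rderiv `[0, T] f t (f' t)) ->
    (forall t, 0 <= t <= T -> rderiv `[0, T] f' t (f'' t)) ->
    (forall t, 0 <= t <= T -> 0 <= f'' t) -> 0 <= f 0 -> 0 <= f' 0 ->
  0 <= f T.
Proof.
move=> T0 hf hf' f''0 f0 f'0; apply: le_trans f0 _.
apply: rderiv_ge0 hf _ => // t /andP[t0 tT]; apply: le_trans f'0 _.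
have sub s : 0 <= s <= t -> 0 <= s <= T by move=> /andP[-> /le_trans ->].
apply: (@rderiv_ge0 t f' f'') => // [s /sub sT e e0|s /sub]; last exact: f''0.
have [d d0 h] := hf' _ sT e e0; exists d => // r;
  rewrite /= in_itv /= => /sub rT.
by apply: h; rewrite /= in_itv.
Qed.

Lemma rderivS D D' f a l : D' `<=` D -> rderiv D f a l -> rderiv D' f a l.
Proof. by move=> DD hf e /hf[d d0 h]; exists d => // s /DD; exact: h. Qed.

Lemma rderiv_sqr D a : rderiv D (fun s => s ^+ 2) a (2 * a).
Proof.
by apply: is_derive_rderiv; apply: is_derive_eq; rewrite /GRing.scale /=; ring.
Qed.

Lemma rderiv_lin D k a : rderiv D (fun s => k * s) a k.
Proof.
move=> e e0; exists 1 => // s _ _.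
by rewrite -mulrBr subrr normr0 mulr_ge0 // ltW.
Qed.

(** Taylor bound with zero initial data.  The sharp constant [C / 2] is not
    kept, which spares a fraction in every later estimate. *)
Lemma rderiv2_le (T C : R) f (f' f'' : R -> R) : 0 <= T ->
    (forall t, 0 <= t <= T -> rderiv `[0, T] f t (f' t)) ->
    (forall t, 0 <= t <= T -> rderiv `[0, T] f' t (f'' t)) ->
    (forall t, 0 <= t <= T -> `|f'' t| <= C) -> f 0 = 0 -> f' 0 = 0 ->
  `|f T| <= C * T ^+ 2.
Proof.
move=> T0 hf hf' f''C f0 f'0.
have C0 : 0 <= C by apply: le_trans (f''C 0 _); rewrite ?lexx.
suff hh k : `|k| <= 1 -> 0 <= C / 2 * T ^+ 2 + k * f T.
  have T20 : 0 <= C * T ^+ 2 by rewrite mulr_ge0 ?sqr_ge0.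
  have := hh 1; rewrite normr1 lexx => /(_ isT).
  have := hh (- 1); rewrite normrN1 lexx => /(_ isT).
  by rewrite ler_norml; lra.
move=> k1; apply: (@rderiv2_ge0 T (fun t => C / 2 * t ^+ 2 + k * f t)
  (fun t => C * t + k * f' t) (fun t => C + k * f'' t)) => //.
- move=> t tT; apply: rderivD; last exact/rderivZ/hf.
  have -> : C * t = C / 2 * (2 * t) by field.
  exact/rderivZ/rderiv_sqr.
- by move=> t tT; apply: rderivD; [exact: rderiv_lin|exact/rderivZ/hf'].
- move=> t tT; have := f''C t tT; have h : `|k * f'' t| <= `|f'' t|.
    by rewrite normrM ler_piMl.
  by move=> /(le_trans h); rewrite ler_norml; lra.
- by rewrite f0 expr0n /= !mulr0 addr0.
- by rewrite f'0 !mulr0 addr0.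
Qed.

End real_derivatives.

(** * Quadratic remainders of powers and exponentials *)

Section estimates.
Variable R : realType.

Lemma expi_add (x y : R) : expi (x + y) = expi x * expi y.
Proof.
apply/eqP; rewrite eq_complex /expi /= cosD sinD.
by apply/andP; split; apply/eqP; ring.
Qed.

Lemma expi0 : expi (0 : R) = 1.
Proof. by rewrite /expi cos0 sin0. Qed.

Lemma normc_expi (x : R) : normc (expi x) = 1.
Proof. by rewrite /= cos2Dsin2 sqrtr1. Qed.

Lemma cos_quad (x : R) : `|cos x - 1| <= x ^+ 2.
Proof.
wlog x0 : x / 0 <= x => [H|].
  have [/H //|x0] := leP 0 x; have := H (- x); rewrite cosN sqrrN; apply; lra.
rewrite -[leRHS]mul1r.
apply: (@rderiv2_le R x 1 (fun t => cos t - 1) (fun t => - sin t)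
  (fun t => - cos t)) => //=.
- move=> t _; apply: is_derive_rderiv; apply: is_derive_eq.
  by rewrite /GRing.scale /=; ring.
- move=> t _; apply: is_derive_rderiv; apply: is_derive_eq.
- by move=> t _; rewrite normrN; exact: cos_max.
- by rewrite cos0 subrr.
- by rewrite sin0 oppr0.
Qed.

Lemma sin_quad (x : R) : `|sin x - x| <= x ^+ 2.
Proof.
wlog x0 : x / 0 <= x => [H|].
  have [/H //|x0] := leP 0 x; have := H (- x).
  by rewrite sinN sqrrN -opprD normrN; apply; lra.
rewrite -[leRHS]mul1r.
apply: (@rderiv2_le R x 1 (fun t => sin t - t) (fun t => cos t - 1)
  (fun t => - sin t)) => //=.
- move=> t _; apply: is_derive_rderiv; apply: is_derive_eq.
- move=> t _; apply: is_derive_rderiv; apply: is_derive_eq.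
  by rewrite /GRing.scale /=; ring.
- by move=> t _; rewrite normrN; exact: sin_max.
- by rewrite sin0 subrr.
- by rewrite cos0 subrr.
Qed.

Lemma expi_quad (x : R) :
  normc (expi x - 1 - 'i%C * (x%:C)%C) <= 2 * x ^+ 2.
Proof.
apply: le_trans (normc_le_ReIm _) _.
have := cos_quad x; have := sin_quad x.
have -> : complex.Re (expi x - 1 - 'i%C * (x%:C)%C) = cos x - 1.
  by rewrite /expi /=; ring.
have -> : complex.Im (expi x - 1 - 'i%C * (x%:C)%C) = sin x - x.
  by rewrite /expi /=; ring.
by lra.
Qed.

Lemma expi_lip (x : R) : normc (expi x - 1) <= 3 * `|x|.
Proof.
have x0 := normr_ge0 x; have [x1|x1] := leP `|x| 1; last first.
  apply: le_trans (normcB _ _) _; rewrite normc_expi normc1; lra.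
have -> : expi x - 1 = (expi x - 1 - 'i%C * (x%:C)%C) + 'i%C * (x%:C)%C by ring.
apply: le_trans (normcD _ _) _; rewrite normcM normc_real.
have -> : normc ('i%C : R[i]) = 1 by rewrite /= expr0n expr1n add0r sqrtr1.
have := expi_quad x; rewrite -(real_normK (num_real x)) => h.
have : `|x| ^+ 2 <= `|x| by rewrite expr2 ler_piMl.
lra.
Qed.

Lemma exp_lip (L s t : R) n : 0 <= s <= L -> 0 <= t <= L ->
  L * `|s ^+ n - t ^+ n| <= n%:R * L ^+ n * `|s - t|.
Proof.
move=> /andP[s0 sL] /andP[t0 tL]; have L0 : 0 <= L by lra.
elim: n => [|n IH]; first by rewrite !expr0 subrr normr0 !mulr0 !mul0r.
have -> : s ^+ n.+1 - t ^+ n.+1 = s * (s ^+ n - t ^+ n) + t ^+ n * (s - t).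
  by rewrite !exprS; ring.
apply: (@le_trans _ _ (L * (s * `|s ^+ n - t ^+ n| + t ^+ n * `|s - t|))).
  rewrite ler_wpM2l //; apply: le_trans (ler_normD _ _) _.
  by rewrite !normrM (ger0_norm s0) (ger0_norm (exprn_ge0 n t0)).
rewrite mulrDr mulrCA.
have -> : n.+1%:R * L ^+ n.+1 * `|s - t| =
    L * (n%:R * L ^+ n * `|s - t|) + L * (L ^+ n * `|s - t|).
  by rewrite -natr1 exprS; ring.
apply: lerD; first by apply: ler_pM => //; rewrite mulr_ge0.
by rewrite ler_wpM2l // ler_wpM2r // lerXn2r.
Qed.

Lemma exp_quad (L s t : R) n : 0 <= s <= L -> 0 <= t <= L ->
  L ^+ 2 * `|s ^+ n - t ^+ n - n%:R * t ^+ n.-1 * (s - t)|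
    <= n%:R ^+ 2 * L ^+ n * (s - t) ^+ 2.
Proof.
move=> sL tL; have /andP[s0 sL'] := sL; have /andP[t0 tL'] := tL.
have L0 : 0 <= L by lra.
elim: n => [|n IH].
  by rewrite !expr0 subrr sub0r !mul0r oppr0 normr0 mulr0 expr0n /= !mul0r.
have -> : s ^+ n.+1 - t ^+ n.+1 - n.+1%:R * t ^+ n.+1.-1 * (s - t) =
    s * (s ^+ n - t ^+ n - n%:R * t ^+ n.-1 * (s - t))
    + n%:R * t ^+ n.-1 * (s - t) ^+ 2.
  case: n {IH} => [|n]; first by rewrite /= !expr1 !expr0; ring.
  by rewrite /= !exprS -!natr1; ring.
set X := s ^+ n - _ - _.
apply: (@le_trans _ _ (L ^+ 2 * (s * `|X| + n%:R * t ^+ n.-1 * (s - t) ^+ 2))).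
  rewrite ler_wpM2l ?sqr_ge0 //; apply: le_trans (ler_normD _ _) _.
  rewrite (normrM s) (ger0_norm s0) lerD2l.
  by rewrite ger0_norm // mulr_ge0 ?sqr_ge0 // mulr_ge0 // exprn_ge0.
have h1 : L ^+ 2 * (s * `|X|) <= L * (n%:R ^+ 2 * L ^+ n * (s - t) ^+ 2).
  by rewrite mulrCA; apply: ler_pM => //; rewrite mulr_ge0 ?sqr_ge0.
have h2 : L ^+ 2 * (n%:R * t ^+ n.-1 * (s - t) ^+ 2)
    <= n%:R * L ^+ n.+1 * (s - t) ^+ 2.
  case: n {IH X h1} => [|n] /=; first by rewrite !mul0r mulr0.
  rewrite mulrA ler_wpM2r ?sqr_ge0 // mulrCA ler_wpM2l //.
  by rewrite !exprS expr0 mulr1 !mulrA ler_wpM2l ?mulr_ge0 // lerXn2r.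
rewrite mulrDr; apply: le_trans (lerD h1 h2) _.
have : 0 <= L ^+ n.+1 * (s - t) ^+ 2 by rewrite mulr_ge0 ?sqr_ge0 ?exprn_ge0.
have -> : L * (n%:R ^+ 2 * L ^+ n * (s - t) ^+ 2) + n%:R * L ^+ n.+1 * (s - t)
  ^+ 2
 = (n%:R ^+ 2 + n%:R) * (L ^+ n.+1 * (s - t) ^+ 2) by rewrite (exprS L); ring.
rewrite -mulrA; set Y := _ * _ => Y0; rewrite ler_wpM2r // -natr1.
have := ler0n R n; nra.
Qed.

End estimates.

(** * Superpositions of monomial modes *)

Section modes.
Variables (R : realType) (I : choiceType) (L : R).
Hypothesis L0 : 0 < L.
Implicit Types (a : I -> R[i]) (e : I -> nat) (k : I -> R).

(** The exponent [e i] and the wave number [k i] are functions of an arbitrary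
    index, so that a superposition may repeat modes and all superpositions below
    (over trees, over sequences of trees, and their derivatives) have this
    form. *)
Definition mode a e k (t x : R) (i : I) : R[i] :=
  a i * ((t ^+ e i)%:C)%C * expi (k i * x).

(** Summability on [0 <= t <= L] against every polynomial weight in the exponent
    and the wave number: this class is stable under both derivatives, as these
    multiply coefficients by [e i] or [k i]. *)
Definition fast a e k : Prop := forall r : nat, exists C,
  sum_le (fun i => normc (a i) * L ^+ e i * (1 + (e i)%:R) ^+ r
                   * (1 + `|k i|) ^+ r) C.

Definition modesum a e k (t x : R) : R[i] :=
  xget 0 [set s | has_sum (mode a e k t x) s].

Lemma fast_sum_le a e k (b : I -> R) r K : fast a e k -> 0 <= K ->
    (forall i, b i <= K * (normc (a i) * L ^+ e i * (1 + (e i)%:R) ^+ r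
                           * (1 + `|k i|) ^+ r)) ->
  exists2 C, 0 <= C & sum_le b C.
Proof.
move=> /(_ r)[C hC] K0 hb; exists (K * C).
  by rewrite mulr_ge0 // (sum_le_ge0 hC).
exact: sum_leW hb (sum_leZ K0 hC).
Qed.

Lemma normc_mode a e k t x i : 0 <= t <= L ->
  normc (mode a e k t x i) <= normc (a i) * L ^+ e i.
Proof.
move=> /andP[t0 tL]; rewrite !normcM normc_expi mulr1 normc_real.
rewrite ler_wpM2l ?normc_ge0 // ger0_norm ?exprn_ge0 //.
by rewrite lerXn2r ?nnegrE //; lra.
Qed.

Lemma mode_summable a e k t x : fast a e k -> 0 <= t <= L ->
  exists C, sum_le (fun i => normc (mode a e k t x i)) C.
Proof.
move=> /(_ 0)[C hC] tL; exists C; apply: sum_leW hC => i.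
by rewrite !expr0 !mulr1 normc_mode.
Qed.

Lemma modesumP a e k t x : fast a e k -> 0 <= t <= L ->
  has_sum (mode a e k t x) (modesum a e k t x).
Proof.
move=> af tL; have [C /abs_has_sum[s hs]] := mode_summable x af tL.
by rewrite /modesum; case: xgetP => // /(_ s).
Qed.

(** Termwise differentiation is reduced to summing quadratic remainders, which
    avoids any exchange of limits. *)
Lemma has_deriv_within_quad (D : set R) (f : R -> R[i]) (c : R) (l : R[i]) C :
    (forall s, D s ->
      normc (f s - f c - l * ((s - c)%:C)%C) <= C * (s - c) ^+ 2) ->
  has_deriv_within D f c l.
Proof.
move=> h; apply/has_deriv_withinP => eps eps0.
have C0 : 0 < `|C| + 1 by have := normr_ge0 C; lra.
exists (eps / (`|C| + 1)) => [|s Ds]; first by rewrite divr_gt0.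
rewrite ltr_pdivlMr // => sd; apply: le_trans (h s Ds) _.
rewrite -(real_normK (num_real (s - c))) expr2 mulrA ler_wpM2r //.
apply: le_trans (ltW sd); rewrite mulrC ler_wpM2l //.
by have := ler_norm C; lra.
Qed.

Definition dt_coef a e i : R[i] := a i * (e i)%:R.
Definition dx_coef a k i : R[i] := a i * ('i%C * ((k i)%:C)%C).

Lemma normc_nat n : normc (n%:R : R[i]) = n%:R.
Proof. by rewrite -(rmorph_nat (real_complex R)) normc_real normr_nat. Qed.

Lemma normc_i : normc ('i%C : R[i]) = 1.
Proof. by rewrite /= expr0n expr1n add0r sqrtr1. Qed.

Lemma fast_dt a e k :
  fast a e k -> fast (dt_coef a e) (fun i => (e i).-1) k.
Proof.
move=> af r.
have [||C _ hC] := @fast_sum_le a e k (fun i => normc (dt_coef a e i)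
   * L ^+ (e i).-1 * (1 + (e i).-1%:R) ^+ r * (1 + `|k i|) ^+ r) r.+1 L^-1 af.
- by rewrite invr_ge0 ltW.
- move=> i; rewrite /dt_coef normcM normc_nat.
  have k1 : 1 <= 1 + `|k i| by rewrite lerDl.
  have k0 : 0 <= 1 + `|k i| by lra.
  rewrite [leRHS]mulrA; apply: ler_pM.
  + by rewrite !mulr_ge0 ?exprn_ge0 ?normc_ge0 ?addr_ge0 // ltW.
  + by rewrite exprn_ge0.
  + rewrite -!mulrA [leRHS]mulrCA ler_wpM2l ?normc_ge0 // {af k1 k0}.
    have L10 : 0 <= L^-1 by rewrite invr_ge0 ltW.
    case: (e i) => [|n] /=.
      by rewrite mul0r mul1r mulr_ge0 // exprn_ge0 // addr_ge0.
    rewrite (exprS L) -!mulrA mulKf ?gt_eqF // mulrCA ler_wpM2l //.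
      by rewrite exprn_ge0 // ltW.
    rewrite exprS; apply: ler_pM => //.
      by rewrite lerDr.
    by rewrite lerXn2r ?nnegrE ?addr_ge0 // lerD2l ler_nat.
  + by apply: ler_weXn2l.
by exists C.
Qed.

Lemma fast_coef a b e k C m : fast a e k -> 0 <= C ->
    (forall i, normc (b i) <= C * (1 + `|k i|) ^+ m * normc (a i)) ->
  fast b e k.
Proof.
move=> af C0 ba r.
have [|D _ hD] := @fast_sum_le a e k (fun i => normc (b i)
   * L ^+ e i * (1 + (e i)%:R) ^+ r * (1 + `|k i|) ^+ r) (m + r) C af C0.
- move=> i.
  have k1 : 1 <= 1 + `|k i| by rewrite lerDl.
  have k0 : 0 <= 1 + `|k i| by lra.
  rewrite (exprD (1 + `|k i|)).
  set E := (1 + (e i)%:R) ^+ (m + r).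
  have -> : C * (normc (a i) * L ^+ e i * E *
      ((1 + `|k i|) ^+ m * (1 + `|k i|) ^+ r))
    = C * (1 + `|k i|) ^+ m * normc (a i) * L ^+ e i * E * (1 + `|k i|) ^+ r.
    by ring.
  rewrite ler_wpM2r ?exprn_ge0 //.
  have e1 : 1 <= 1 + (e i)%:R :> R by rewrite lerDl.
  have e0 : 0 <= 1 + (e i)%:R :> R by lra.
  apply: ler_pM.
  + by rewrite mulr_ge0 ?normc_ge0 ?exprn_ge0 // ltW.
  + by rewrite exprn_ge0.
  + by rewrite ler_wpM2r // exprn_ge0 // ltW.
  + by rewrite ler_weXn2l // leq_addl.
by exists D.
Qed.

Lemma fast_dx a e k : fast a e k -> fast (dx_coef a k) e k.
Proof.
move=> af; apply: (fast_coef (m := 1) af ler01) => i.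
rewrite /dx_coef !normcM normc_i normc_real !mul1r mulrC expr1.
by rewrite ler_wpM2r ?normc_ge0 // lerDr.
Qed.

Lemma is_dt_modesum a e k : fast a e k ->
  is_dt L (modesum a e k) (modesum (dt_coef a e) (fun i => (e i).-1) k).
Proof.
move=> af t x tL.
have [||C C0 hC] := @fast_sum_le a e k (fun i => L^-2 * (normc (a i)
   * ((e i)%:R ^+ 2 * L ^+ e i))) 2 (L^-2) af.
- by rewrite invr_ge0 exprn_ge0 // ltW.
- move=> i; rewrite ler_wpM2l ?invr_ge0 ?exprn_ge0 ?(ltW L0) //.
  have -> : normc (a i) * ((e i)%:R ^+ 2 * L ^+ e i)
    = normc (a i) * L ^+ e i * ((e i)%:R ^+ 2 * 1) by ring.
  rewrite -[leRHS]mulrA ler_wpM2l ?mulr_ge0 ?normc_ge0 ?exprn_ge0 ?(ltW L0) //.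
  apply: ler_pM => //.
    by rewrite lerXn2r ?nnegrE ?addr_ge0 // lerDr.
  by rewrite exprn_ege1 // lerDl.
apply: (@has_deriv_within_quad _ _ _ _ C) => s; rewrite /= in_itv /= => sL.
have := has_sumB (has_sumB (modesumP x af sL) (modesumP x af tL))
  (has_sumZ ((s - t)%:C)%C (modesumP x (fast_dt af) tL)).
rewrite [_%:C%C * _]mulrC => /has_sum_normc; apply.
rewrite mulrC; apply: sum_leW (sum_leZ (sqr_ge0 (s - t)) hC) => i.
have -> : mode a e k s x i - mode a e k t x i - ((s - t)%:C)%C *
    mode (dt_coef a e) (fun i => (e i).-1) k t x i
  = a i * ((s ^+ e i - t ^+ e i - (e i)%:R * t ^+ (e i).-1 * (s - t))%:C)%C
    * expi (k i * x).
  by rewrite /mode /dt_coef !rmorphB !rmorphM rmorph_nat /=; ring.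
rewrite !normcM normc_expi mulr1 normc_real mulrCA [leRHS]mulrCA.
have := exp_quad (e i) sL tL; rewrite mulrC -ler_pdivlMr ?exprn_gt0 // => h.
apply: le_trans (ler_wpM2l (normc_ge0 (a i)) h) _.
rewrite le_eqVlt; apply/orP; left; apply/eqP; rewrite -exprVn; ring.
Qed.

Lemma is_dx_modesum a e k : fast a e k ->
  is_dx L (modesum a e k) (modesum (dx_coef a k) e k).
Proof.
move=> af t x tL.
have [||C C0 hC] := @fast_sum_le a e k (fun i => normc (a i)
   * L ^+ e i * (2 * `|k i| ^+ 2)) 2 2 af => //.
- move=> i; have -> : normc (a i) * L ^+ e i * (2 * `|k i| ^+ 2)
    = 2 * (normc (a i) * L ^+ e i * (1 * `|k i| ^+ 2)) by ring.
  rewrite ler_wpM2l // -[leRHS]mulrA.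
  rewrite ler_wpM2l ?mulr_ge0 ?normc_ge0 ?exprn_ge0 ?(ltW L0) //.
  apply: ler_pM => //; first by rewrite exprn_ege1 // lerDl.
  by rewrite lerXn2r ?nnegrE ?addr_ge0 // lerDr.
apply: (@has_deriv_within_quad _ _ _ _ C) => y _.
have := has_sumB (has_sumB (modesumP y af tL) (modesumP x af tL))
  (has_sumZ ((y - x)%:C)%C (modesumP x (fast_dx af) tL)).
rewrite [_%:C%C * _]mulrC => /has_sum_normc; apply.
rewrite mulrC; apply: sum_leW (sum_leZ (sqr_ge0 (y - x)) hC) => i.
have -> : mode a e k t y i - mode a e k t x i - ((y - x)%:C)%C *
    mode (dx_coef a k) e k t x i
  = a i * ((t ^+ e i)%:C)%C * expi (k i * x) *
    (expi (k i * (y - x)) - 1 - 'i%C * ((k i * (y - x))%:C)%C).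
  rewrite /mode /dx_coef (_ : k i * y = k i * x + k i * (y - x)); last by ring.
  by rewrite expi_add !rmorphM /=; ring.
rewrite normcM mulrC.
have := normc_mode a e k x i tL; rewrite /mode => h1.
have := expi_quad (k i * (y - x)) => h2.
apply: le_trans (ler_pM (normc_ge0 _) (normc_ge0 _) h2 h1) _.
rewrite le_eqVlt; apply/orP; left; apply/eqP.
by rewrite (real_normK (num_real (k i))); ring.
Qed.

Lemma strip_continuous_modesum a e k : fast a e k ->
  strip_continuous L (modesum a e k).
Proof.
move=> af; apply/strip_continuousP => t x eps tL eps0.
have [||C C0 hC] := @fast_sum_le a e k (fun i => (normc (a i) * L ^+ e i)
   * (L^-1 * (e i)%:R + 3 * `|k i|)) 1 (L^-1 + 3) af.
- by rewrite addr_ge0 // invr_ge0 ltW.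
- move=> i; rewrite [leRHS]mulrC -!mulrA ler_wpM2l ?normc_ge0 //.
  rewrite ler_wpM2l ?exprn_ge0 ?(ltW L0) // !expr1.
  have L1 : 0 <= L^-1 by rewrite invr_ge0 ltW.
  have e0 := ler0n R (e i); have k0 := normr_ge0 (k i).
  have h1 : 0 <= L^-1 * `|k i| by rewrite mulr_ge0.
  have h2 : 0 <= (e i)%:R * `|k i| by rewrite mulr_ge0.
  have h3 : 0 <= L^-1 * ((e i)%:R * `|k i|) by rewrite mulr_ge0.
  by nra.
have C1 : 0 < C + 1 by lra.
exists (eps / (C + 1)) => [|s y sL]; first by rewrite divr_gt0.
rewrite !ltr_pdivlMr // => st yx.
have H : normc (modesum a e k s y - modesum a e k t x)
    <= Num.max `|s - t| `|y - x| * C.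
  have := has_sumB (modesumP y af sL) (modesumP x af tL).
  have m0 : 0 <= Num.max `|s - t| `|y - x| by rewrite le_max normr_ge0.
  move=> /has_sum_normc; apply; apply: sum_leW (sum_leZ m0 hC) => i.
  have -> : mode a e k s y i - mode a e k t x i =
      a i * ((s ^+ e i - t ^+ e i)%:C)%C * expi (k i * y)
      + a i * ((t ^+ e i)%:C)%C * expi (k i * x) * (expi (k i * (y - x)) - 1).
    rewrite /mode rmorphB (_ : k i * y = k i * x + k i * (y - x)); last by ring.
    by rewrite expi_add; ring.
  apply: le_trans (normcD _ _) _.
  set m := Num.max _ _ in m0 *.
  have sm : `|s - t| <= m by rewrite le_max lexx.
  have ym : `|y - x| <= m by rewrite le_max lexx orbT.
  rewrite (mulrDr (normc (a i) * _)) (mulrDr m); apply: lerD.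
    rewrite !normcM normc_expi mulr1 normc_real.
    have := exp_lip (e i) sL tL; rewrite mulrC -ler_pdivlMr // => h.
    apply: le_trans (ler_wpM2l (normc_ge0 (a i)) h) _.
    have -> : normc (a i) * ((e i)%:R * L ^+ e i * `|s - t| / L)
      = `|s - t| * (normc (a i) * L ^+ e i * (L^-1 * (e i)%:R)) by ring.
    rewrite ler_wpM2r // !mulr_ge0 ?invr_ge0 ?normc_ge0 ?exprn_ge0 //.
      by rewrite ltW.
    by rewrite ltW.
  rewrite normcM; apply: le_trans (ler_pM (normc_ge0 _) (normc_ge0 _)
    (normc_mode a e k x i tL) (expi_lip _)) _.
  rewrite normrM.
  have -> : normc (a i) * L ^+ e i * (3 * (`|k i| * `|y - x|))
    = `|y - x| * (normc (a i) * L ^+ e i * (3 * `|k i|)) by ring.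
  rewrite ler_wpM2r // !mulr_ge0 ?normc_ge0 ?exprn_ge0 //.
  by rewrite ltW.
apply: le_lt_trans H _.
have h1 : Num.max `|s - t| `|y - x| * (C + 1) < eps by rewrite /Num.max;
  case: ifP.
have h2 : 0 <= Num.max `|s - t| `|y - x| by rewrite le_max normr_ge0.
by apply: le_lt_trans h1; rewrite mulrDr mulr1 lerDl.
Qed.

End modes.

(** * Families indexed by sequences *)

Section seq_modes.
Variables (R : realType) (I : choiceType) (L : R).
Hypothesis L0 : 0 < L.
Implicit Types (a : I -> R[i]) (e : I -> nat) (k : I -> R).

Definition seq_coef a (m : nat) (s : seq I) : R[i] :=
  if size s == m then \prod_(i <- s) a i else 0.
Definition seq_deg e (s : seq I) : nat := (\sum_(i <- s) e i)%N.
Definition seq_freq k (s : seq I) : R := \sum_(i <- s) k i.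

Lemma le_add1_sum_prod (f : I -> R) (s : seq I) : (forall i, 0 <= f i) ->
  1 + \sum_(i <- s) f i <= \prod_(i <- s) (1 + f i).
Proof.
move=> f0; elim: s => [|i s IH]; first by rewrite !big_nil addr0.
rewrite !big_cons; apply: le_trans (ler_wpM2l _ IH); last by rewrite addr_ge0.
have : 0 <= \sum_(j <- s) f j by apply: sumr_ge0.
have := f0 i; nra.
Qed.

Lemma fast_seq a e k m :
  fast L a e k -> fast L (seq_coef a m) (seq_deg e) (seq_freq k).
Proof.
move=> af r; have [C hC] := af r; exists (C ^+ m).
set w := (X in sum_le X C) in hC.
have w0 i : 0 <= w i.
  by rewrite !mulr_ge0 ?exprn_ge0 ?normc_ge0 ?addr_ge0 // ltW.
apply: sum_leW (sum_le_seq m w0 hC) => s; rewrite /seq_coef.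
case: ifP => _; last by rewrite normc0 !mul0r.
rewrite /w !big_split /= normc_prod !prodrXl.
have d0 : 1 <= 1 + (seq_deg e s)%:R :> R by rewrite lerDl.
have k0 : 1 <= 1 + `|seq_freq k s| by rewrite lerDl.
have p0 : 0 <= \prod_(i <- s) normc (a i) * \prod_(i <- s) L ^+ e i.
  by rewrite mulr_ge0 ?prodr_ge0 // => i _;
    rewrite ?normc_ge0 ?exprn_ge0 // ltW.
have -> : L ^+ seq_deg e s = \prod_(i <- s) L ^+ e i.
  rewrite /seq_deg; elim: s {d0 k0 p0} => [|i s IH]; first by rewrite !big_nil.
  by rewrite !big_cons exprD IH.
have d00 := le_trans ler01 d0; have k00 := le_trans ler01 k0.
apply: ler_pM; [by rewrite mulr_ge0 // exprn_ge0 | exact: exprn_ge0 | |].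
- apply: ler_wpM2l => //; rewrite lerXn2r ?nnegrE ?prodr_ge0 ?addr_ge0 //.
  rewrite /seq_deg natr_sum; exact: le_add1_sum_prod.
- rewrite lerXn2r ?nnegrE ?prodr_ge0 ?addr_ge0 //.
  apply: le_trans (le_add1_sum_prod s (fun i => normr_ge0 (k i))).
  by rewrite lerD2l; exact: ler_norm_sum.
Qed.

Lemma mode_seq a e k m t x s :
  mode (seq_coef a m) (seq_deg e) (seq_freq k) t x s
  = if size s == m then \prod_(i <- s) mode a e k t x i else 0.
Proof.
rewrite /mode /seq_coef; case: ifP => _; last by rewrite !mul0r.
elim: s => [|i s IH].
  by rewrite !big_nil /seq_deg /seq_freq !big_nil mul0r expi0 !mulr1.
rewrite !big_cons -IH /seq_deg /seq_freq !big_cons mulrDl expi_add exprD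
  rmorphM.
by rewrite /=; ring.
Qed.

Lemma modesum_seq a e k m t x : fast L a e k -> 0 <= t <= L ->
  modesum (seq_coef a m) (seq_deg e) (seq_freq k) t x = modesum a e k t x ^+ m.
Proof.
move=> af tL; have [C hC] := mode_summable x af tL.
apply: has_sum_unique (modesumP x (fast_seq m af) tL) _.
rewrite (funext (mode_seq a e k m t x)).
exact: has_sum_seq hC (modesumP x af tL).
Qed.

End seq_modes.

(** * Sums over trees *)

Section tree_sums.
Variables (R : realType) (X : choiceType) (p : nat).
Local Notation tree := (GenTree.tree X).

Definition branching (i : nat) (s : seq tree) : bool :=
  (i == 0%N) && ((size s == 1%N) || (size s == p)).

(** Majorant principle.  Let [V h] be the part of [W] carried by the trees of
    height below [h]: splitting off the root shows that its total is at most
    [C + Q * (D + D ^+ p) <= D] when this holds one level below, and a finite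
      set
    of trees has bounded height. *)
Lemma tree_sum_le (W : tree -> R) (C Q D : R) :
    p != 1%N -> 0 <= Q -> (forall t, 0 <= W t) ->
    sum_le (fun x => W (GenTree.Leaf x)) C ->
    (forall i s, W (GenTree.Node i s)
      <= if branching i s then Q * \prod_(t <- s) W t else 0) ->
    0 <= D -> C + Q * (D + D ^+ p) <= D ->
  sum_le W D.
Proof.
move=> p1 Q0 W0 WC Wnode D0 CD.
pose fix V (h : nat) (t : tree) {struct h} : R :=
  if h is h'.+1 then match t with
  | GenTree.Leaf x => W (GenTree.Leaf x)
  | GenTree.Node i s => if branching i s then Q * \prod_(t' <- s) V h' t' else 0
  end else 0.
have V0 h t : 0 <= V h t.
  elim: h t => [|h IH] [x|i s] //=; case: ifP => // _.
  by rewrite mulr_ge0 // prodr_ge0.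
have VD h : sum_le (V h) D.
  elim: h => [|h IH]; first by move=> F; rewrite big1.
  have Ns m := sum_leZ Q0 (sum_le_seq m (V0 h) IH).
  apply: sum_le_trans CD _.
  pose f1 t : R := if t is GenTree.Leaf x then W (GenTree.Leaf x) else 0.
  pose f2 m t : R := if t is GenTree.Node i s then
    if i == 0%N then Q * (if size s == m then \prod_(t' <- s) V h t' else 0)
    else 0 else 0.
  have h2 m : sum_le (f2 m) (Q * D ^+ m).
    apply: (@sum_le_image R (seq tree) _ (GenTree.Node 0)) => //.
    - by move=> s1 s2 [].
    - by case=> // -[|i] s //= /(_ s).
    - exact: (Ns m).
  have h1 : sum_le f1 C.
    apply: (@sum_le_image R X _ (@GenTree.Leaf X)) => //.
    - by move=> s1 s2 [].
    - by case=> // x /(_ x).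
  have h12 : sum_le (fun t => f1 t + (f2 1%N t + f2 p t)) (C + Q * (D + D ^+
    p)).
    rewrite mulrDr; apply: sum_leD h1 (sum_leD _ (h2 p)).
    by have := h2 1%N; rewrite expr1.
  apply: sum_leW h12; case=> [x|i s] /=; first by rewrite !addr0.
  rewrite /branching; case: (i =P 0%N) => [_|_] /=; last by rewrite !addr0.
  rewrite add0r; case: (size s =P 1%N) => [->|_] /=.
    by rewrite eq_sym (negbTE p1) mulr0 addr0.
  by rewrite mulr0 add0r; case: ifP; rewrite ?mulr0.
have WV t : exists h0, forall h, (h0 <= h)%N -> W t <= V h t.
  elim: t => [x|i s IH]; first by exists 1%N => -[].
  have [h0 hh0] : exists h0, forall h, (h0 <= h)%N ->
      \prod_(t <- s) W t <= \prod_(t <- s) V h t.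
    elim: s IH {i} => [|t s IHs] /=; first by exists 0%N => h _;
      rewrite !big_nil.
    move=> [[h1 hh1] /IHs[h2 hh2]]; exists (maxn h1 h2) => h.
    rewrite geq_max => /andP[/hh1 k1 /hh2 k2]; rewrite !big_cons.
    by apply: ler_pM => //; apply: prodr_ge0.
  exists h0.+1 => -[//|h] /hh0 k /=; apply: le_trans (Wnode i s) _.
  by case: ifP => // _; rewrite ler_wpM2l.
move=> F.
have [h hh] : exists h0, forall h, (h0 <= h)%N ->
    \sum_(t <- F) W t <= \sum_(t <- F) V h t.
  elim: {F}(F : seq tree) => [|t s [h1 hh1]].
    by exists 0%N => h _; rewrite !big_nil.
  have [h2 hh2] := WV t; exists (maxn h1 h2) => h.
  rewrite geq_max => /andP[/hh1 k1 /hh2 k2]; rewrite !big_cons.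
  exact: lerD.
exact: le_trans (hh h (leqnn h)) (VD h F).
Qed.

End tree_sums.

(** * Exponentially decaying lattice families *)

Section lattice.
Variable R : realType.

Lemma sum_le_geometric (q : R) : 0 <= q < 1 ->
  sum_le (fun n : nat => q ^+ n) (1 - q)^-1.
Proof.
move=> /andP[q0 q1] F; have q10 : 0 < 1 - q by rewrite subr_gt0.
pose N := (\max_(n <- F) n).+1.
have FN n : n \in F -> (n < N)%N by move=> nF; rewrite ltnS;
  apply: leq_bigmax_seq.
have -> : \sum_(n <- F) q ^+ n = \sum_(n <- iota 0 N | n \in F) q ^+ n.
  rewrite -[RHS]big_filter; apply: perm_big; apply: uniq_perm;
    first exact: fset_uniq.
    by rewrite filter_uniq // iota_uniq.
  move=> n; rewrite mem_filter mem_iota /= add0n.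
  by case: (boolP (n \in F)) => [/FN ->|].
apply: (@le_trans _ _ (\sum_(n <- iota 0 N) q ^+ n)).
  by rewrite [leLHS]big_mkcond /=; apply: ler_sum => n _; case: ifP => // _;
    rewrite exprn_ge0.
have -> : iota 0 N = index_iota 0 N by rewrite /index_iota subn0.
rewrite big_mkord -[leRHS]mul1r ler_pdivlMr // mulrC.
by rewrite -opprB mulNr -subrX1 opprB lerBlDr lerDl exprn_ge0.
Qed.

Lemma expR_decay (d : R) n : expR (- (d * n%:R)) = expR (- d) ^+ n.
Proof. by rewrite -mulNr expRM_natr. Qed.

Lemma sum_le_int (q : R) : 0 <= q < 1 ->
  sum_le (fun m : int => q ^+ `|m|%N) ((1 + q) / (1 - q)).
Proof.
move=> q01; have /andP[q0 q1] := q01.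
pose f1 (m : int) : R := if m is Posz n then q ^+ n else 0.
pose f2 (m : int) : R := if m is Negz n then q * q ^+ n else 0.
have h1 : sum_le f1 (1 - q)^-1.
  apply: (@sum_le_image R nat _ Posz) => //.
  - by move=> m n [].
  - by case=> // n /(_ n).
  - exact: sum_le_geometric.
have h2 : sum_le f2 (q * (1 - q)^-1).
  apply: (@sum_le_image R nat _ Negz) => //.
  - by move=> m n [].
  - by case=> // n /(_ n).
  - exact/sum_leZ/sum_le_geometric.
rewrite mulrDl mul1r; have := sum_leD h1 h2.
by apply: sum_leW => -[n|n] /=; rewrite ?addr0 ?add0r // -exprS.
Qed.

(** The weight is a product over coordinates, and in each coordinate the
    geometric series gives [(1 + q) / (1 - q) <= 1 + 4 / rho <= 6 / rho] for
    [q = expR (- (rho / 2))]. *)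
Lemma sum_le_lattice (nu : nat) (rho : R) : 0 < rho <= 1 ->
  sum_le (fun n : 'rV[int]_nu => expR (- (rho / 2 * (norm1 n)%:R)))
         (b_const nu rho).
Proof.
move=> /andP[r0 r1]; pose q := expR (- (rho / 2)).
have q0 : 0 < q by exact: expR_gt0.
have qr : q * (1 + rho / 2) <= 1.
  rewrite /q expRN mulrC ler_pdivrMr ?expR_gt0 // mul1r.
  exact: expR_ge1Dx.
have q1 : q < 1 by nra.
have q01 : 0 <= q < 1 by rewrite (ltW q0).
have hC : (1 + q) / (1 - q) <= 6 * rho^-1.
  rewrite ler_pdivrMr ?subr_gt0 // mulrAC ler_pdivlMr //; nra.
have := sum_le_trans hC (sum_le_int q01).
have w0 (m : int) : 0 <= q ^+ `|m|%N by rewrite exprn_ge0 // ltW.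
move=> /(sum_le_seq nu w0).
pose f (n : 'rV[int]_nu) : seq int := [seq n 0 j | j <- enum 'I_nu].
have f_inj : injective f.
  move=> m n /eq_in_map h; apply/rowP => j; rewrite (h j) //.
  by rewrite mem_enum.
move=> /(sum_le_comp f_inj); apply: sum_leW => n.
rewrite size_map size_enum_ord eqxx big_map big_enum /= expR_decay -/q.
suff -> : \prod_(i < nu) q ^+ `|n ord0 i|%N = q ^+ norm1 n by [].
rewrite /norm1; elim/big_rec2: _ => [|j m r _ ->]; first by rewrite expr0.
by rewrite exprD.
Qed.

End lattice.

(** * The tree expansion of the solution *)

(** Take the [r]-th power of a linear bound
    [1 + y <= C' * expR (d * y / r.+1)]. *)
Lemma exp_dominates_poly (R : realType) (r : nat) (d : R) : 0 < d ->
  exists2 C : R, 0 <= C & forall y, 0 <= y -> (1 + y) ^+ r <= C * expR (d * y).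
Proof.
move=> d0; pose m : R := r.+1%:R.
have m0 : 0 < m by rewrite ltr0Sn.
have md0 : 0 < m / d by rewrite divr_gt0.
exists ((1 + m / d) ^+ r) => [|y y0]; first by rewrite exprn_ge0 //; lra.
have e1 : 1 <= expR (d * y / m).
  by apply: le_trans (expR_ge1Dx _); rewrite lerDl !mulr_ge0 ?invr_ge0 // ltW.
have ey : y <= m / d * expR (d * y / m).
  have := expR_ge1Dx (d * y / m); rewrite -(ler_pM2l md0) mulrDr mulr1.
  have -> : m / d * (d * y / m) = y by field; rewrite ?gt_eqF.
  by lra.
have : (1 + y) ^+ r <= ((1 + m / d) * expR (d * y / m)) ^+ r.
  have md1 : 0 <= 1 + m / d by lra.
  have y1 : 0 <= 1 + y by lra.
  rewrite lerXn2r ?nnegrE ?mulr_ge0 ?expR_ge0 //.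
  by rewrite mulrDl mul1r lerD.
move=> /le_trans; apply; rewrite exprMn ler_wpM2l ?exprn_ge0 //; first by lra.
rewrite -expRM_natl ler_expR mulrCA ler_piMr ?mulr_ge0 ?(ltW d0) //.
by rewrite ler_pdivrMr // mul1r ler_nat.
Qed.

Section trees.
Variables (R : realType) (nu p : nat) (omega : 'rV[R]_nu).
Variables (c d : 'rV[int]_nu -> R[i]).
Local Notation tree := (GenTree.tree (bool * 'rV[int]_nu)).

(** A leaf [(b, n)] stands for [c n] if [b] is false and for [t * d n] if [b] is
    true.  A node integrates twice in time, hence the degree shift by 2 and the
    two factors in the denominator of [tcoef]. *)
Fixpoint tdeg (t : tree) : nat := match t with
  | GenTree.Leaf x => x.1
  | GenTree.Node _ s => (foldr (fun t m => tdeg t + m)%N 0%N s).+2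
  end.

Fixpoint tfreq (t : tree) : 'rV[int]_nu := match t with
  | GenTree.Leaf x => x.2
  | GenTree.Node _ s => foldr (fun t m => tfreq t + m) 0 s
  end.

Definition twave (t : tree) : R := inner (tfreq t) omega.

Definition lambda (k : R) : R := k ^+ 2 / (1 + k ^+ 2).

Fixpoint tcoef (t : tree) : R[i] := match t with
  | GenTree.Leaf x => if x.1 then d x.2 else c x.2
  | GenTree.Node i s => if branching p i s then
      ((- (lambda (twave t) / ((tdeg t)%:R * (tdeg t).-1%:R)))%:C)%C
      * foldr (fun t m => tcoef t * m) 1 s
    else 0
  end.

Lemma tdeg_node i s : tdeg (GenTree.Node i s) = (seq_deg tdeg s).+2.
Proof.
rewrite /seq_deg /=; elim: s => [|t s IH]; first by rewrite big_nil.
by rewrite big_cons /= -!addnS IH.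
Qed.

Lemma tfreq_node i s : tfreq (GenTree.Node i s) = \sum_(t <- s) tfreq t.
Proof. by rewrite /=; elim: s => [|t s IH];
  rewrite ?big_nil // big_cons /= IH. Qed.

Lemma inner0 : inner (0 : 'rV[int]_nu) omega = 0.
Proof. by rewrite /inner big1 // => j _; rewrite mxE mul0r. Qed.

Lemma innerD (m n : 'rV[int]_nu) :
  inner (m + n) omega = inner m omega + inner n omega.
Proof.
by rewrite /inner -big_split /=; apply: eq_bigr => j _;
  rewrite mxE intrD mulrDl.
Qed.

Lemma twave_node i s : twave (GenTree.Node i s) = seq_freq twave s.
Proof.
rewrite /twave tfreq_node /seq_freq; elim: s => [|t s IH].
  by rewrite !big_nil inner0.
by rewrite !big_cons innerD IH.
Qed.

Lemma tcoef_node i s : tcoef (GenTree.Node i s) = if branching p i s then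
  ((- (lambda (seq_freq twave s)
       / ((seq_deg tdeg s).+2%:R * (seq_deg tdeg s).+1%:R)))%:C)%C
    * \prod_(t <- s) tcoef t else 0.
Proof.
have -> : \prod_(t <- s) tcoef t = foldr (fun t m => tcoef t * m) 1 s.
  by elim: s => [|t s IH]; rewrite ?big_nil // big_cons IH.
by rewrite -(twave_node i) -[(seq_deg tdeg s).+1]/(seq_deg tdeg s).+2.-1
  -(tdeg_node i).
Qed.

Lemma norm10 : norm1 (0 : 'rV[int]_nu) = 0%N.
Proof. by rewrite /norm1 big1 // => j _; rewrite mxE absz0. Qed.

Lemma norm1D (m n : 'rV[int]_nu) : (norm1 (m + n) <= norm1 m + norm1 n)%N.
Proof.
rewrite /norm1 -big_split /=; apply: leq_sum => j _; rewrite mxE.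
by rewrite -lez_nat PoszD !abszE; exact: ler_normD.
Qed.

Lemma norm1_sum (s : seq tree) (f : tree -> 'rV[int]_nu) :
  (norm1 (\sum_(t <- s) f t)%R <= \sum_(t <- s) norm1 (f t))%N.
Proof.
elim: s => [|t s IH]; first by rewrite !big_nil norm10.
by rewrite !big_cons (leq_trans (norm1D _ _)) // leq_add2l.
Qed.

Lemma inner_le (n : 'rV[int]_nu) :
  `|inner n omega| <= (\sum_j `|omega 0 j|) * (norm1 n)%:R.
Proof.
rewrite /inner; apply: le_trans (ler_norm_sum _ _ _) _.
rewrite mulr_suml; apply: ler_sum => j _; rewrite normrM mulrC ler_wpM2l //.
rewrite -intr_norm /norm1 (bigD1 j) //= natrD -[leLHS]addr0.
by apply: lerD.
Qed.

Lemma lambda_bound k : 0 <= lambda k <= 1.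
Proof.
have k2 := sqr_ge0 k; have k1 : 0 < 1 + k ^+ 2 by lra.
rewrite /lambda divr_ge0 ?(ltW k1) //= ler_pdivrMr //; lra.
Qed.

Variables (rho L : R).
Hypothesis L0 : 0 < L.

(** The modulus of the contribution of [t] at time [2 * L] rather than [L]: the
    powers of 2 dominate the polynomials in [tdeg t] coming from derivatives. *)
Definition tweight (t : tree) : R :=
  normc (tcoef t) * (2 * L) ^+ tdeg t * expR (rho / 2 * (norm1 (tfreq t))%:R).

Lemma tweight_ge0 t : 0 <= tweight t.
Proof.
by rewrite !mulr_ge0 ?normc_ge0 ?expR_ge0 // exprn_ge0 // mulr_ge0 // ltW.
Qed.

(** Submultiplicativity.  The factor [1 / 2] is the largest value of
    [1 / ((m + 2) * (m + 1))], and [lambda <= 1]. *)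
Lemma tweight_node i s : 0 <= rho -> tweight (GenTree.Node i s)
  <= if branching p i s then (2 * L) ^+ 2 / 2 * \prod_(t <- s) tweight t else 0.
Proof.
move=> rho0; rewrite /tweight tcoef_node; case: ifP => _; last first.
  by rewrite normc0 !mul0r.
rewrite tdeg_node tfreq_node normcM normc_real normrN normc_prod.
set N := seq_deg tdeg s; set l := lambda _.
have lb : `|l / (N.+2%:R * N.+1%:R)| <= 2^-1.
  have /andP[l0 l1] : 0 <= l <= 1 := lambda_bound _.
  have n2 : 2 <= N.+2%:R :> R by rewrite ler_nat.
  have n1 : 1 <= N.+1%:R :> R by rewrite ler1n.
  have n0 : 2 <= N.+2%:R * N.+1%:R :> R by nra.
  move: (N.+2%:R * N.+1%:R) n0 => y n0.
  have y0 : 0 < y by lra.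
  rewrite ger0_norm; last by rewrite divr_ge0 // ltW.
  by rewrite ler_pdivrMr //; lra.
rewrite -(addn2 N) exprD addn2.
rewrite !big_split /=.
have -> : \prod_(t <- s) (2 * L) ^+ tdeg t = (2 * L) ^+ N.
  rewrite /N /seq_deg; elim: s {N l lb} => [|t s IH]; first by rewrite !big_nil.
  by rewrite !big_cons exprD IH.
set P := \prod_(t <- s) normc _.
have P0 : 0 <= P by apply: prodr_ge0 => t _; exact: normc_ge0.
have LL0 n : 0 <= (2 * L) ^+ n by rewrite exprn_ge0 // mulr_ge0 // ltW.
have he : expR (rho / 2 * (norm1 (\sum_(t <- s) tfreq t))%:R)
    <= \prod_(t <- s) expR (rho / 2 * (norm1 (tfreq t))%:R).
  rewrite -expR_sum ler_expR -mulr_sumr ler_wpM2l ?divr_ge0 //.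
  by rewrite -natr_sum ler_nat norm1_sum.
have -> : (2 * L) ^+ 2 / 2 * (P * (2 * L) ^+ N *
    \prod_(t <- s) expR (rho / 2 * (norm1 (tfreq t))%:R)) =
  (2^-1 * P * ((2 * L) ^+ N * (2 * L) ^+ 2)) *
    \prod_(t <- s) expR (rho / 2 * (norm1 (tfreq t))%:R) by field.
apply: ler_pM he; rewrite ?expR_ge0 //; first by rewrite !mulr_ge0 // ltW.
by apply: ler_wpM2r; [rewrite mulr_ge0 | rewrite ler_wpM2r].
Qed.

Lemma tree_fast D : 0 < rho -> sum_le tweight D -> fast L tcoef tdeg twave.
Proof.
move=> rho0 WD r.
have ln20 : 0 < ln 2 :> R by rewrite ln_gt0 // ltr1n.
have [C1 C10 h1] := exp_dominates_poly r ln20.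
pose Om := \sum_j `|omega 0 j|.
have Om0 : 0 <= Om by apply: sumr_ge0.
have Om1 : 0 < Om + 1 by lra.
have [|C2 C20 h2] := @exp_dominates_poly R r (rho / 2 / (Om + 1)).
  by rewrite divr_gt0 // divr_gt0.
exists (C1 * C2 * D); have C12 : 0 <= C1 * C2 by rewrite mulr_ge0.
apply: sum_leW (sum_leZ C12 WD) => t; rewrite /tweight exprMn.
have k1 : (1 + (tdeg t)%:R) ^+ r <= C1 * 2 ^+ tdeg t.
  have := h1 (tdeg t)%:R (ler0n _ _); rewrite expRM_natr lnK // posrE.
  by rewrite ltr0n.
have k2 : (1 + `|twave t|) ^+ r <= C2 * expR (rho / 2 * (norm1 (tfreq t))%:R).
  apply: le_trans (h2 _ (normr_ge0 _)) _; rewrite ler_wpM2l // ler_expR.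
  rewrite -mulrA ler_wpM2l ?divr_ge0 ?(ltW rho0) // mulrC ler_pdivrMr //.
  apply: le_trans (inner_le _) _; rewrite mulrC ler_wpM2l //; rewrite -/Om; lra.
have a0 := normc_ge0 (tcoef t);
  have l0 : 0 <= L ^+ tdeg t by rewrite exprn_ge0 // ltW.
have -> : C1 * C2 * (normc (tcoef t) * (2 ^+ tdeg t * L ^+ tdeg t) *
   expR (rho / 2 * (norm1 (tfreq t))%:R)) =
  normc (tcoef t) * L ^+ tdeg t * (C1 * 2 ^+ tdeg t) *
   (C2 * expR (rho / 2 * (norm1 (tfreq t))%:R)) by ring.
have y0 : 0 <= (1 + (tdeg t)%:R) ^+ r :> R by rewrite exprn_ge0 // addr_ge0.
have al0 : 0 <= normc (tcoef t) * L ^+ tdeg t by rewrite mulr_ge0.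
apply: ler_pM k2; [by rewrite mulr_ge0 | by rewrite exprn_ge0 // addr_ge0 | ].
by rewrite ler_wpM2l.
Qed.

End trees.

(** * Existence *)

Lemma exp_decayP (R : realType) (nu : nat) (A rho : R)
    (c : 'rV[int]_nu -> R[i]) : exp_decay A rho c <->
  forall n, normc (c n) <= A * expR (- (rho * (norm1 n)%:R)).
Proof. by split=> h n; move: (h n); rewrite -lecR. Qed.

Section existence.
Variables (R : realType) (nu p : nat) (omega : 'rV[R]_nu).
Hypothesis hp : (3 <= p)%N.
Variables (c d : 'rV[int]_nu -> R[i]) (A rho : R).
Hypotheses (A0 : 0 < A) (rho0 : 0 < rho) (rho1 : rho <= 1).
Hypotheses (hc : exp_decay A rho c) (hd : exp_decay A rho d).
Let M := M_const nu A rho.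
Let L := L_const nu p A rho.
Local Notation coef := (tcoef p omega c d).
Local Notation deg := (@tdeg nu).
Local Notation wave := (@twave R nu omega).

Lemma M_ge1 : 1 <= M.
Proof. by rewrite /M /M_const le_max lexx. Qed.

Lemma L_gt0 : 0 < L.
Proof.
have M1 := M_ge1; rewrite /L /L_const -/M divr_gt0 // !mulr_gt0 ?exprn_gt0 //.
  by rewrite ltr0n (leq_trans _ hp).
by apply: lt_le_trans M1.
Qed.

(** The product [L * (2 * M) ^+ p] is exactly [M / (8 * p)]. *)
Lemma L_pow : L * (2 * M) ^+ p <= M / 24 /\ L <= 192^-1.
Proof.
have M1 := M_ge1; have M0 : 0 < M by apply: lt_le_trans M1.
have p3 : 3 <= p%:R :> R by rewrite ler_nat.
have p0 : 0 < p%:R :> R by apply: lt_le_trans p3.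
have X1 : 1 <= M ^+ (p - 1) by rewrite exprn_ege1.
have X0 : 0 < M ^+ (p - 1) by apply: lt_le_trans X1.
have Y0 : 0 < 2 ^+ p :> R by rewrite exprn_gt0.
have Y8 : 8 <= 2 ^+ p :> R.
  rewrite (_ : 8 = 2 ^+ 3); last by rewrite -natrX.
  by rewrite ler_weXn2l // ler1n.
rewrite /L /L_const -/M exprD.
have -> : (2 * M) ^+ p = 2 ^+ p * (M ^+ (p - 1) * M).
  by rewrite exprMn -exprSr subn1 prednK // (leq_trans _ hp).
set X := M ^+ _ in X1 X0 *; set Y := 2 ^+ p in Y0 Y8 *;
  set P := p%:R in p3 p0 *.
have -> : 2 ^+ 3 = 8 :> R by rewrite -natrX.
split.
  have -> : 1 / (P * (Y * 8) * X) * (Y * (X * M)) = M / (P * 8).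
    by field; rewrite !gt_eqF.
  rewrite ler_pM2l // lef_pV2 ?posrE ?mulr_gt0 //; lra.
rewrite div1r lef_pV2 ?posrE ?mulr_gt0 //.
have h1 : 24 <= P * Y.
  by rewrite (_ : 24 = 3 * 8); [apply: ler_pM | rewrite -natrM].
have h2 : 192 <= P * Y * 8 * X.
  apply: (@le_trans _ _ (P * Y * 8)); first by lra.
  by rewrite ler_peMr // !mulr_ge0 // ltW.
by rewrite mulrA.
Qed.

(** Only the sizes [L <= 1 / 192] and [L * (2 * M) ^+ p <= M / 24] matter. *)
Lemma const_contraction :
  (M + 2 * L * M) + (2 * L) ^+ 2 / 2 * (2 * M + (2 * M) ^+ p) <= 2 * M.
Proof.
have [h1 h2] := L_pow; have L0 := L_gt0; have M1 := M_ge1.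
have -> : (2 * L) ^+ 2 / 2 * (2 * M + (2 * M) ^+ p)
  = 2 * L * (2 * (L * M) + L * (2 * M) ^+ p) by field.
move: (L * (2 * M) ^+ p) h1 => Z h1.
have h3 : L * M <= 192^-1 * M by rewrite ler_wpM2r //; lra.
have h4 : L * (2 * (L * M) + Z) <= L * M by rewrite ler_wpM2l ?(ltW L0) //; lra.
by rewrite -(mulrA 2 L M) -(mulrA 2 L (_ + _)); lra.
Qed.

Lemma decay_sum_le (f : 'rV[int]_nu -> R[i]) : exp_decay A rho f ->
  sum_le (fun n => normc (f n) * expR (rho / 2 * (norm1 n)%:R)) M.
Proof.
move=> /exp_decayP hf.
have r01 : 0 < rho <= 1 by rewrite rho0.
have AM : A * b_const nu rho <= M by rewrite /M /M_const le_max lexx orbT.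
apply: sum_leW (sum_le_trans AM (sum_leZ (ltW A0) (sum_le_lattice r01))) => n.
apply: le_trans (ler_wpM2r (expR_ge0 _) (hf n)) _.
rewrite -[leLHS]mulrA -expRD ler_wpM2l ?(ltW A0) // ler_expR.
by rewrite le_eqVlt; apply/orP; left; apply/eqP; field.
Qed.

Let weight := tweight p omega c d rho L.

Lemma tree_weight_le : sum_le weight (2 * M).
Proof.
have L0 := L_gt0; have M1 := M_ge1.
apply: (@tree_sum_le R _ p weight (M + 2 * L * M) ((2 * L) ^+ 2 / 2)).
- by rewrite neq_ltn (leq_trans _ hp) ?orbT.
- by rewrite divr_ge0 ?sqr_ge0.
- by move=> t; exact: tweight_ge0.
- pose f (b : bool) (x : bool * 'rV[int]_nu) : R :=
    if x.1 == b then weight (GenTree.Leaf x) else 0.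
  have hf b C : sum_le (fun n =>
    weight (GenTree.Leaf (b, n))) C -> sum_le (f b) C.
    move=> h; apply: (@sum_le_image R _ _ (fun n => (b, n))).
    - by move=> m n [].
    - by move=> [b' n] /(_ n); rewrite /f /=; case: eqP => // -> /(_ erefl).
    - by apply: sum_leW h => n; rewrite /f eqxx.
  have h1 : sum_le (f false) M.
    apply: hf; apply: sum_leW (decay_sum_le hc) => n.
    by rewrite /weight /tweight /= expr0 mulr1.
  have h2 : sum_le (f true) (2 * L * M).
    apply: hf; have L20 : 0 <= 2 * L by rewrite mulr_ge0 // ltW.
    apply: sum_leW (sum_leZ L20 (decay_sum_le hd)) => n.
    by rewrite /weight /tweight /= expr1 mulrAC mulrC -mulrA.
  apply: sum_leW (sum_leD h1 h2) => -[[] n].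
    by rewrite /f /= add0r.
  by rewrite /f /= addr0.
- by move=> i s; apply: tweight_node => //; exact: ltW.
- by rewrite mulr_ge0 //; lra.
- exact: const_contraction.
Qed.

Lemma sol_fast : fast L coef deg wave.
Proof. exact: (@tree_fast _ _ _ _ _ _ _ _ L_gt0 _ rho0 tree_weight_le). Qed.

Definition sol (t x : R) : R[i] := modesum coef deg wave t x.

Definition sol_hat (t : R) (n : 'rV[int]_nu) : R[i] :=
  xget 0 [set s | has_sum (fun tau => if tfreq tau == n
                             then coef tau * ((t ^+ deg tau)%:C)%C else 0) s].

Lemma sol_hat_term (t : R) n tau : 0 <= t <= L ->
  normc (if tfreq tau == n then coef tau * ((t ^+ deg tau)%:C)%C else 0)
  <= expR (- (rho / 2 * (norm1 n)%:R)) * weight tau.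
Proof.
move=> /andP[t0 tL]; have L0 := L_gt0.
have w0 : 0 <= weight tau := tweight_ge0 p omega c d rho L0 tau.
case: eqP => [<-|_]; last by rewrite normc0 mulr_ge0 ?expR_ge0.
rewrite normcM normc_real /weight /tweight mulrCA -expRD addNr expR0 mulr1.
rewrite ler_wpM2l ?normc_ge0 // ger0_norm ?exprn_ge0 // lerXn2r ?nnegrE //.
  by rewrite mulr_ge0 // ltW.
by lra.
Qed.

Lemma sol_hatP (t : R) n : 0 <= t <= L ->
  has_sum (fun tau => if tfreq tau == n
             then coef tau * ((t ^+ deg tau)%:C)%C else 0) (sol_hat t n).
Proof.
move=> tL; have := sum_leZ (expR_ge0 (- (rho / 2 * (norm1 n)%:R)))
  tree_weight_le.
move=> /(sum_leW (fun tau => sol_hat_term n tau tL)) /abs_has_sum[s hs].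
by rewrite /sol_hat; case: xgetP => // /(_ s).
Qed.

Lemma sol_hat_decay (t : R) : 0 <= t <= L ->
  exp_decay (B_const nu A rho) (rho / 2) (sol_hat t).
Proof.
move=> tL; apply/exp_decayP => n; apply: has_sum_normc (sol_hatP n tL) _.
have := sum_leZ (expR_ge0 (- (rho / 2 * (norm1 n)%:R))) tree_weight_le.
move=> /(sum_leW (fun tau => sol_hat_term n tau tL)).
by rewrite /B_const -/M [_ * expR _]mulrC.
Qed.

Lemma sol_qp (t x : R) : 0 <= t <= L -> qp_sum omega (sol_hat t) x (sol t x).
Proof.
move=> tL; apply: (has_sum_fiber (N := @tfreq nu) _ (modesumP x sol_fast tL)).
move=> n; rewrite mulrC.
apply: eq_has_sum (has_sumZ (expi (inner n omega * x)) (sol_hatP n tL)) => tau.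
by rewrite /mode; case: eqP => [<-|_]; rewrite ?mulr0 // mulrC.
Qed.

Local Notation list_coef m := (seq_coef coef m).
Local Notation list_deg := (seq_deg deg).
Local Notation list_wave := (seq_freq wave).
Local Notation coef_xx a k := (dx_coef (dx_coef a k) k).
Local Notation coef_tt a e := (dt_coef (dt_coef a e) (fun i => (e i).-1)).
Local Notation deg2 e := (fun i => (e i).-1.-1).

Lemma coef_xxE (I : choiceType) (a : I -> R[i]) (k : I -> R) i :
  coef_xx a k i = a i * ((- k i ^+ 2)%:C)%C.
Proof.
rewrite /dx_coef -mulrA mulrACA -expr2 sqr_i -expr2 rmorphN rmorphXn /=.
by rewrite mulN1r.
Qed.

(** The equation, tree by tree: a node contributes to [u_tt - u_xxtt] what its
    list of children contributes to [(u + u ^+ p)_xx]. *)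
Lemma sol_equation (t x : R) : 0 <= t <= L ->
  modesum (coef_tt coef deg) (deg2 deg) wave t x
  - modesum (coef_xx coef wave) deg wave t x
  - modesum (coef_tt (coef_xx coef wave) deg) (deg2 deg) wave t x
  - modesum (coef_xx (list_coef p) list_wave) list_deg list_wave t x = 0.
Proof.
move=> tL; have L0 := L_gt0; have af := sol_fast.
have hxx := modesumP x (fast_dx L0 (fast_dx L0 af)) tL.
have htt := modesumP x (fast_dt L0 (fast_dt L0 af)) tL.
have hxxtt := modesumP x (fast_dt L0 (fast_dt L0 (fast_dx L0 (fast_dx L0 af))))
  tL.
have hp' := modesumP x (fast_dx L0 (fast_dx L0 (fast_seq L0 p af))) tL.
have hsum : has_sum (fun s =>
    (if size s == 1%N then \prod_(tau <- s)
       mode (coef_xx coef wave) deg wave t x tau else 0)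
    + mode (coef_xx (list_coef p) list_wave) list_deg list_wave t x s)
  (modesum (coef_xx coef wave) deg wave t x
   + modesum (coef_xx (list_coef p) list_wave) list_deg list_wave t x).
  apply: has_sumD hp'.
  have [C hC] := mode_summable x (fast_dx L0 (fast_dx L0 af)) tL.
  by have := has_sum_seq 1 hC hxx; rewrite expr1.
have hnode := @has_sum_image R _ _ (GenTree.Node 0)
  (fun tau => mode (coef_tt coef deg) (deg2 deg) wave t x tau
   - mode (coef_tt (coef_xx coef wave) deg) (deg2 deg) wave t x tau).
have := has_sumB htt hxxtt.
move=> /has_sum_unique/(_ (hnode _ _ _ _)) h.
suff E : modesum (coef_tt coef deg) (deg2 deg) wave t x
   - modesum (coef_tt (coef_xx coef wave) deg) (deg2 deg) wave t x
   = modesum (coef_xx coef wave) deg wave t x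
   + modesum (coef_xx (list_coef p) list_wave) list_deg list_wave t x.
  by rewrite (addrAC (modesum _ _ _ _ _)) E; ring.
apply: h.
- by move=> s1 s2 [].
- move=> [[b n]|i s] hi; rewrite /mode /dt_coef /dx_coef /=.
    by case: b {hi}; rewrite /= ?mulr0 ?mul0r ?mulr0 ?mul0r subrr.
  case: i hi => [/(_ s)//|i _].
  by rewrite !mul0r subrr.
apply: eq_has_sum hsum => s.
have node : mode (coef_tt coef deg) (deg2 deg) wave t x (GenTree.Node 0 s)
    - mode (coef_tt (coef_xx coef wave) deg) (deg2 deg) wave t x
        (GenTree.Node 0 s)
  = (if branching p 0 s then \prod_(tau <- s) coef tau else 0)
    * ((- list_wave s ^+ 2)%:C)%C * ((t ^+ list_deg s)%:C)%C
    * expi (list_wave s * x).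
  rewrite /mode /dt_coef coef_xxE tcoef_node tdeg_node twave_node /=.
  case: ifP => _; last by rewrite !mul0r subrr.
  set k := seq_freq _ s; set N := seq_deg _ s.
  have k0 : 1 + k ^+ 2 != 0 by rewrite gt_eqF // ltr_wpDr ?sqr_ge0.
  have lamE : ((- k ^+ 2)%:C)%C = ((- (lambda k / (N.+2%:R * N.+1%:R)))%:C)%C
      * N.+2%:R * N.+1%:R * (1 - ((- k ^+ 2)%:C)%C) :> R[i].
    rewrite -!(rmorph_nat (real_complex R)) -(rmorph1 (real_complex R)).
    rewrite -rmorphB -!rmorphM /=; congr (_%:C)%C; rewrite /lambda natrM.
    have a0 : N.+1%:R != 0 :> R by rewrite pnatr_eq0.
    have b0 : N.+2%:R != 0 :> R by rewrite pnatr_eq0.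
    move: (N.+1%:R) (N.+2%:R) a0 b0 => y z y0 z0.
    by field; rewrite y0 z0 k0.
  by rewrite [in RHS]lamE; ring.
rewrite node /mode coef_xxE /seq_coef /branching /=.
have [s1|_] := eqVneq (size s) 1%N; last first.
  by rewrite add0r /=; case: ifP => // _; rewrite !mul0r.
have -> : (size s == p) = false.
  by rewrite s1; apply/negbTE; rewrite neq_ltn (leq_trans _ hp).
rewrite !mul0r addr0 /=; case: s s1 {node} => [//|tau [|//]] _.
by rewrite !big_seq1 coef_xxE /seq_freq /seq_deg !big_seq1.
Qed.

Lemma initial_has_sum (f : 'rV[int]_nu -> R[i]) x : exp_decay A rho f ->
  exists s, qp_sum omega f x s.
Proof.
move=> /decay_sum_le h; apply: (@abs_has_sum _ _ _ M).
apply: sum_leW h => n; rewrite normcM normc_expi mulr1 ler_peMr ?normc_ge0 //.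
by rewrite -expR0 ler_expR mulr_ge0 // divr_ge0 // ltW.
Qed.

Lemma zero_in_range : 0 <= (0 : R) <= L.
Proof. by rewrite lexx ltW // L_gt0. Qed.

Lemma sol_initial x : qp_sum omega c x (sol 0 x).
Proof.
have [s hs] := initial_has_sum x hc; suff -> : sol 0 x = s by [].
apply: has_sum_unique (modesumP x sol_fast zero_in_range) _.
apply: (has_sum_image (f := fun n => GenTree.Leaf (false, n))).
- by move=> m n [].
- move=> [[[] n]|i l] h; rewrite /mode.
  + by rewrite /= expr1 mulr0 mul0r.
  + by case: (h n).
  + by rewrite tdeg_node expr0n mulr0 mul0r.
- by apply: eq_has_sum hs => n; rewrite /mode /= expr0 mulr1.
Qed.

Lemma sol_initial_dt x :
  qp_sum omega d x (modesum (dt_coef coef deg) (fun i => (deg i).-1) wave 0 x).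
Proof.
have L0 := L_gt0; have [s hs] := initial_has_sum x hd.
suff -> : modesum (dt_coef coef deg) (fun i => (deg i).-1) wave 0 x = s by [].
apply: has_sum_unique (modesumP x (fast_dt L0 sol_fast) zero_in_range) _.
apply: (has_sum_image (f := fun n => GenTree.Leaf (true, n))).
- by move=> m n [].
- move=> [[[] n]|i l] h; rewrite /mode /dt_coef.
  + by case: (h n).
  + by rewrite /= mulr0 !mul0r.
  + by rewrite tdeg_node expr0n mulr0 mul0r.
- by apply: eq_has_sum hs => n; rewrite /mode /dt_coef /= expr0 !mulr1.
Qed.

Lemma sol_classical : classical_qp_solution p omega c d L sol sol_hat.
Proof.
have L0 := L_gt0; have af := sol_fast; have pf := fast_seq L0 p af.
split; first exact: sol_qp.
exists (modesum (dt_coef coef deg) (fun i => (deg i).-1) wave).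
exists (modesum (coef_tt coef deg) (deg2 deg) wave).
exists (modesum (dx_coef coef wave) deg wave).
exists (modesum (coef_xx coef wave) deg wave).
exists (modesum (dt_coef (coef_xx coef wave) deg) (fun i => (deg i).-1) wave).
exists (modesum (coef_tt (coef_xx coef wave) deg) (deg2 deg) wave).
exists (modesum (dx_coef (list_coef p) list_wave) list_deg list_wave).
exists (modesum (coef_xx (list_coef p) list_wave) list_deg list_wave).
have f_x := fast_dx L0 af; have f_xx := fast_dx L0 f_x.
have f_t := fast_dt L0 af; have f_xxt := fast_dt L0 f_xx.
have p_x := fast_dx L0 pf.
split; [split; split|split].
- exact: is_dt_modesum.
- exact: is_dt_modesum.
- exact: is_dx_modesum.
- exact: is_dx_modesum.
- exact: is_dt_modesum.
- exact: is_dt_modesum.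
- move=> t x tL; have -> : (fun x => sol t x ^+ p)
    = modesum (list_coef p) list_deg list_wave t.
    by apply/funext => y; rewrite (modesum_seq L0 _ _ af tL).
  exact: (is_dx_modesum L0 pf).
- exact: is_dx_modesum.
- split; apply: strip_continuous_modesum => //.
  + exact: fast_dt.
  + exact: fast_dt.
  + exact: fast_dx.
- split; [exact: sol_equation|exact: sol_initial|exact: sol_initial_dt].
Qed.

End existence.

(** * Second differences and a maximum principle *)

Section uniqueness.
Variable R : realType.
Implicit Types (f g : R -> R) (L : R).

Definition diff2 (h : R) f (x : R) : R := f (x + h) + f (x - h) - 2 * f x.

(** A bounded [y] whose second differences approximate [y - F] locally uniformly
    stays below the bound of [F].  A maximum need not be attained; at a point
    where [y x - k * x ^+ 2] nearly attains its supremum the second difference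
    is nearly nonpositive, which suffices. *)
Lemma max_principle (y F : R -> R) (K m : R) :
    (forall x, `|y x| <= K) -> (forall x, F x <= m) ->
    (forall r e : R, 0 < e -> exists2 h, 0 < h & forall x, `|x| <= r ->
       `|diff2 h y x - h ^+ 2 * (y x - F x)| <= e * h ^+ 2) ->
  forall x, y x <= m.
Proof.
move=> yK Fm Dy x0; apply/ler_addgt0Pr => e e0.
have K0 : 0 <= K by apply: le_trans (yK 0).
have c0 : 0 < 6 + x0 ^+ 2 by have := sqr_ge0 x0; lra.
pose k := e / (6 + x0 ^+ 2); have k0 : 0 < k by rewrite divr_gt0.
have kE : k * (6 + x0 ^+ 2) = e by rewrite /k divfK // gt_eqF.
pose f x := y x - k * x ^+ 2.
have fK x : f x <= K.
  have : 0 <= k * x ^+ 2 by rewrite mulr_ge0 ?sqr_ge0 // ltW.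
  by have := yK x; rewrite ler_norml /f; lra.
pose A := [set f x | x in setT].
have hA : has_sup A.
  by split; [exists (f 0), 0|exists K => _ [x _ <-]].
set S := sup A.
have fS x : f x <= S by apply: sup_upper_bound => //; exists x.
(* near-maximizers of [f] lie in [-r, r], whatever [h] is *)
pose r := (2 * K + 1) / k + 1.
have [h h0 hh] := Dy r k k0.
pose d := Num.min (Num.min 1 k) (k * h ^+ 2).
have d0 : 0 < d by rewrite !lt_min ltr01 k0 mulr_gt0 // exprn_gt0.
have [_ [x1 _ <-] hx1] := sup_adherent d0 hA; rewrite -/S in hx1.
have : d <= 1 /\ d <= k /\ d <= k * h ^+ 2 by rewrite !ge_min !lexx !orbT.
move=> [d1 [dk dh]].
have x1r : `|x1| <= r.
  have h1 : k * x1 ^+ 2 <= 2 * K + 1.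
    have := fS 0; have := yK 0; have := yK x1; rewrite /f expr0n /= in hx1 *.
    by rewrite !ler_norml; lra.
  have h2 : `|x1| ^+ 2 <= (2 * K + 1) / k.
    by rewrite (real_normK (num_real x1)) ler_pdivlMr // mulrC.
  rewrite /r; have := normr_ge0 x1; nra.
have := hh x1 x1r; rewrite ler_norml => /andP[lb _].
have D1 : diff2 h y x1 <= 4 * k * h ^+ 2.
  have := fS (x1 + h); have := fS (x1 - h); rewrite /f /diff2 in hx1 *.
  have -> : k * (x1 + h) ^+ 2 = k * x1 ^+ 2 + 2 * k * x1 * h + k * h ^+ 2 by
    ring.
  have -> : k * (x1 - h) ^+ 2 = k * x1 ^+ 2 - 2 * k * x1 * h + k * h ^+ 2 by
    ring.
  by lra.
have h20 : 0 < h ^+ 2 by rewrite exprn_gt0.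
have D2 : y x1 - F x1 <= 5 * k.
  by rewrite -(ler_pM2l h20); lra.
have x10 : 0 <= k * x1 ^+ 2 by rewrite mulr_ge0 ?sqr_ge0 // ltW.
have := fS x0; have := Fm x1; rewrite mulrDr in kE.
by rewrite /f in hx1 *; lra.
Qed.

Lemma rderiv_shift D f x a l :
  rderiv setT f (x + a) l -> rderiv D (fun s => f (x + s)) a l.
Proof.
move=> h e /h[d d0 hd]; exists d => // s _ sa.
have E : x + s - (x + a) = s - a by ring.
by have := hd (x + s) I; rewrite E => /(_ sa).
Qed.

Lemma rderiv_reflect D f x a l :
  rderiv setT f (x - a) l -> rderiv D (fun s => f (x - s)) a (- l).
Proof.
move=> h e /h[d d0 hd]; exists d => // s _ sa.
have E : x - s - (x - a) = - (s - a) by ring.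
by have := hd (x - s) I; rewrite E normrN mulrN mulNr => /(_ sa).
Qed.

(** Second differences involve only the values of the second derivative near
  [x],
    so continuity of the latter turns them into [h ^+ 2 * f'' x]. *)
Lemma diff2_le f f' f'' (x h m e : R) : 0 <= h ->
    (forall y, rderiv setT f y (f' y)) ->
      (forall y, rderiv setT f' y (f'' y)) ->
    (forall y, `|y - x| <= h -> `|f'' y - m| <= e) ->
  `|diff2 h f x - h ^+ 2 * m| <= 2 * e * h ^+ 2.
Proof.
move=> h0 hf hf' hm.
have -> : diff2 h f x - h ^+ 2 * m
  = f (x + h) + f (x - h) - (2 * f x + m * h ^+ 2) by rewrite /diff2; ring.
apply: (@rderiv2_le R h (2 * e) (fun t =>
  f (x + t) + f (x - t) - (2 * f x + m * t ^+ 2))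
  (fun t => f' (x + t) - f' (x - t) - (2 * m) * t)
  (fun t => f'' (x + t) + f'' (x - t) - 2 * m)) => //.
- move=> t _; apply: rderivB.
    by apply: rderivD; [apply: rderiv_shift | apply: rderiv_reflect].
  have -> : 2 * m * t = 0 + m * (2 * t) by ring.
  apply: rderivD; last exact/rderivZ/rderiv_sqr.
  by move=> e' e'0; exists 1 => // s _ _;
    rewrite subrr mul0r subrr normr0 mulr_ge0 // ltW.
- move=> t _; apply: rderivB; last exact: rderiv_lin.
  apply: rderivD; first exact: rderiv_shift.
  by rewrite -[f'' _]opprK; apply: rderivN; exact: rderiv_reflect.
- move=> t /andP[t0 th]; have h1 : `|f'' (x + t) - m| <= e.
    by apply: hm; rewrite addrAC subrr add0r ger0_norm.
  have h2 : `|f'' (x - t) - m| <= e.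
    by apply: hm; rewrite addrAC subrr add0r normrN ger0_norm.
  have -> : f'' (x + t) + f'' (x - t) - 2 * m
    = (f'' (x + t) - m) + (f'' (x - t) - m) by ring.
  by apply: le_trans (ler_normD _ _) _; lra.
- by rewrite addr0 subr0 expr0n /= mulr0; ring.
- by rewrite addr0 subr0 mulr0; ring.
Qed.

Definition strip_cts L (f : R -> R -> R) : Prop := forall t x e : R,
  0 <= t <= L -> 0 < e -> exists2 d : R, 0 < d & forall t' x', 0 <= t' <= L ->
    `|t' - t| < d -> `|x' - x| < d -> `|f t' x' - f t x| < e.

Lemma strip_compact L (r : R) :
  compact (`[0, L]%classic `*` `[- r, r]%classic : set (R * R)).
Proof. by apply: compact_setX; exact: segment_compact. Qed.

(** Heine's theorem in the direction of [x], uniformly in [t]. *)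
Lemma strip_unif L (f : R -> R -> R) (r e : R) : strip_cts L f -> 0 < e ->
  exists2 h, 0 < h & forall t x x', 0 <= t <= L -> `|x| <= r ->
    `|x' - x| <= h ->
    `|f t x' - f t x| <= e.
Proof.
move=> fc e0.
have /compact_near_coveringP := @strip_compact L r.
move=> /(_ R 0^'+ (fun h z => forall x', `|x' - z.2| <= h ->
   0 <= z.1 <= L -> `|f z.1 x' - f z.1 z.2| <= e)).
move=> [].
  move=> [t x] [/=]; rewrite !in_itv /= => tL _.
  have e20 : 0 < e / 2 by lra.
  have [d d0 hd] := fc t x _ tL e20; have d20 : 0 < d / 2 by lra.
  exists (ball (t, x) (d / 2), [set h | h < d / 2]).
    split; first exact: nbhsx_ballx.
    exact: nbhs_right_lt.
  move=> [[t' x'] h] [[/= h1 h2] h3] x'' hx t'L.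
  have h4 : `|x' - x| < d by move: h2; rewrite /ball /= distrC; lra.
  have h5 : `|t' - t| < d by move: h1; rewrite /ball /= distrC; lra.
  have h6 : `|x'' - x| < d.
    have -> : x'' - x = (x'' - x') + (x' - x) by ring.
    apply: le_lt_trans (ler_normD _ _) _; move: h2 h3 hx.
    by rewrite /ball /= (distrC x); lra.
  have := hd t' x'' t'L h5 h6; have := hd t' x' t'L h5 h4.
  have -> : f t' x'' - f t' x' = (f t' x'' - f t x) - (f t' x' - f t x) by ring.
  by move=> k1 k2; apply: le_trans (ler_normB _ _) _; lra.
move=> d /= d0 hd; have d20 : 0 < d / 2 by lra.
exists (d / 2) => // t x x' tL xr x'x; apply: (hd (d / 2) _ d20 (t, x)) => //.
  by rewrite /= sub0r normrN gtr0_norm //; lra.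
by split; rewrite /= in_itv //= -ler_norml.
Qed.

Lemma strip_bounded L (f : R -> R -> R) (r : R) : strip_cts L f ->
  exists2 C, 0 <= C & forall t x, 0 <= t <= L -> `|x| <= r -> `|f t x| <= C.
Proof.
move=> fc.
have /compact_near_coveringP := @strip_compact L r.
move=> /(_ R +oo (fun C z => 0 <= z.1 <= L -> `|f z.1 z.2| <= C)).
move=> [].
  move=> [t x] [/=]; rewrite !in_itv /= => tL _.
  have [d d0 hd] := fc t x _ tL ltr01.
  exists (ball (t, x) d, [set C | `|f t x| + 1 < C]).
    split; first exact: nbhsx_ballx.
    by apply: nbhs_pinfty_gt; exact: num_real.
  move=> [[t' x'] C] [[/= h1 h2] h3] t'L.
  move: h1 h2; rewrite /ball /= !(distrC _ t') !(distrC _ x') => h1 h2.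
  have := hd t' x' t'L h1 h2.
  have -> : f t' x' = (f t' x' - f t x) + f t x by ring.
  move=> k; apply: le_trans (ler_normD _ _) _; rewrite addrK in k *.
  by lra.
move=> M /= [_ hM]; have M1 : M < `|M| + 1.
  by rewrite (le_lt_trans (ler_norm M)) // ltrDl.
exists (`|M| + 1) => [|t x tL xr]; first by rewrite addr_ge0.
apply: (hM _ M1 (t, x)) => //.
by split; rewrite /= in_itv //= -ler_norml.
Qed.

End uniqueness.

(** * Primitives *)

Section real_estimate.
Variable R : realType.

Lemma primitive (L : R) (f : R -> R) : 0 <= L ->
    (forall t e : R, 0 <= t <= L -> 0 < e -> exists2 d : R, 0 < d &
       forall s, 0 <= s <= L -> `|s - t| < d -> `|f s - f t| < e) ->
  exists F : R -> R, F 0 = 0 /\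
    forall t, 0 <= t <= L -> rderiv `[0, L] F t (f t).
Proof.
move=> L0 fc.
(* extend [f] by constants, to differentiate the integral at the endpoints *)
pose cl (s : R) : R := if s <= 0 then 0 else if s <= L then s else L.
have clL s : 0 <= cl s <= L.
  by rewrite /cl; have [_|s0] := leP s 0; [|have [|_] := leP s L]; lra.
have clid s : 0 <= s <= L -> cl s = s.
  move=> /andP[s0 sL]; rewrite /cl sL; have [|//] := leP s 0; lra.
have cl1 s t : `|cl s - cl t| <= `|s - t|.
  have h1 := ler_norm (s - t); have h2 := ler_norm (t - s).
  rewrite distrC in h2; rewrite ler_norml /cl.
  have [s0|s0] := leP s 0; have [t0|t0] := leP t 0.
  - by lra.
  - by have [t1|t1] := leP t L; lra.
  - by have [s1|s1] := leP s L; lra.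
  - by have [s1|s1] := leP s L; have [t1|t1] := leP t L; lra.
pose g s := f (cl s).
have gc : continuous g.
  move=> t; apply/(@cvgrPdist_lt _ R^o) => e e0.
  have [d d0 hd] := fc (cl t) e (clL t) e0.
  apply/nbhs_ballP; exists d => // s; rewrite /ball /= => ts.
  by rewrite distrC; apply: hd => //; rewrite (le_lt_trans (cl1 _ _)) // distrC.
pose F x := (\int[lebesgue_measure]_(t in [set` `[-1, x]]) (g t))%R.
have gi : lebesgue_measure.-integrable `[-1, L + 1] (EFin \o g).
  apply: continuous_compact_integrable; first exact: segment_compact.
  by apply: continuous_subspaceT; exact: gc.
exists (fun t => F t - F 0); split; first by rewrite subrr.
move=> t tL; have /andP[t0 tL'] := tL.
have [|||Fd Ft] := @continuous_FTC1_closed R g (-1) t (L + 1) _ gi.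
- by lra.
- by lra.
- exact: gc.
have : rderiv `[0, L] F t (f t).
  apply: is_derive_rderiv; split; first exact: Fd.
  by rewrite -derive1E Ft /g clid.
by move=> h e /h[d d0 hd]; exists d => // s Ls /(hd s Ls);
  rewrite opprB addrA subrK.
Qed.

(** * The linear estimate *)

(** The names of the functions record the derivatives they stand for.  Here
    [z_xxt] is the time derivative of [z_xx]; it is tied to [z_t] only at
    time 0, by [z_xxt0]. *)
Section linear.
Variables (L K : R).
Hypothesis L0 : 0 < L.
Variables z z_x z_xx z_t z_tt z_xxt z_xxtt g g_x g_xx : R -> R -> R.
Hypothesis z_dt : forall t x, 0 <= t <= L ->
  rderiv `[0, L] (z ^~ x) t (z_t t x).
Hypothesis z_dtt : forall t x, 0 <= t <= L ->
  rderiv `[0, L] (z_t ^~ x) t (z_tt t x).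
Hypothesis z_dx : forall t x, 0 <= t <= L -> rderiv setT (z t) x (z_x t x).
Hypothesis z_dxx : forall t x, 0 <= t <= L -> rderiv setT (z_x t) x (z_xx t x).
Hypothesis z_dxxt : forall t x, 0 <= t <= L ->
  rderiv `[0, L] (z_xx ^~ x) t (z_xxt t x).
Hypothesis z_dxxtt : forall t x, 0 <= t <= L ->
  rderiv `[0, L] (z_xxt ^~ x) t (z_xxtt t x).
Hypothesis g_dx : forall t x, 0 <= t <= L -> rderiv setT (g t) x (g_x t x).
Hypothesis g_dxx : forall t x, 0 <= t <= L -> rderiv setT (g_x t) x (g_xx t x).
Hypothesis z_tt_cts : strip_cts L z_tt.
Hypothesis z_xx_cts : strip_cts L z_xx.
Hypothesis z_xxtt_cts : strip_cts L z_xxtt.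
Hypothesis g_xx_cts : strip_cts L g_xx.
Hypothesis g_cts : forall x t e : R, 0 <= t <= L -> 0 < e -> exists2 d : R,
  0 < d & forall s, 0 <= s <= L -> `|s - t| < d -> `|g s x - g t x| < e.
Hypothesis z_bounded : forall t x, 0 <= t <= L -> `|z t x| <= K.
Hypothesis z0 : forall x, z 0 x = 0.
Hypothesis z_t0 : forall x, z_t 0 x = 0.
Hypothesis equation : forall t x, 0 <= t <= L ->
  z_tt t x - z_xxtt t x = g_xx t x.

Lemma rderiv_zero (f : R -> R) x l : (forall y, f y = 0) ->
  rderiv setT f x l -> l = 0.
Proof.
move=> f0 hl; apply/eqP; rewrite -normr_le0; apply/ler_addgt0Pr => e e0.
rewrite add0r; have [d d0 hd] := hl e e0; have d2 : 0 < d / 2 by lra.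
have := hd (x + d / 2) I; rewrite !f0 addrAC subrr add0r gtr0_norm //.
have d2d : d / 2 < d by lra.
by move=> /(_ d2d); rewrite subr0 sub0r normrN normrM (gtr0_norm d2) ler_pM2r.
Qed.

Lemma normr_pM (s y : R) : 0 < s -> `|s * y| = s * `|y|.
Proof. by move=> s0; rewrite normrM gtr0_norm. Qed.

Lemma z_xx0 x : z_xx 0 x = 0.
Proof.
have L00 : 0 <= (0 : R) <= L by rewrite lexx ltW.
apply: (@rderiv_zero (z_x 0) x) (z_dxx x L00) => y.
exact: (@rderiv_zero (z 0) y) z0 (z_dx y L00).
Qed.

Lemma itv_sub t : 0 <= t <= L -> `[0, t]%classic `<=` (`[0, L]%classic : set R).
Proof.
move=> /andP[_ tL] s; rewrite /= !in_itv /= => /andP[-> st].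
exact: le_trans tL.
Qed.

Lemma taylor_le (f f' f'' : R -> R) (C t : R) : 0 <= t <= L ->
    (forall s, 0 <= s <= L -> rderiv `[0, L] f s (f' s)) ->
    (forall s, 0 <= s <= L -> rderiv `[0, L] f' s (f'' s)) ->
    (forall s, 0 <= s <= L -> `|f'' s| <= C) -> f 0 = 0 -> f' 0 = 0 ->
  `|f t| <= C * t ^+ 2.
Proof.
move=> tL hf hf' hC f0 f'0; have /andP[t0 tL'] := tL.
have sL s : 0 <= s <= t -> 0 <= s <= L by move=> /andP[-> /le_trans ->].
apply: (@rderiv2_le R t C f f' f'') => // s /sL st.
- exact: rderivS (itv_sub tL) (hf s st).
- exact: rderivS (itv_sub tL) (hf' s st).
- exact: hC.
Qed.

(** [z_xxt 0] is the second [x]-derivative of [z_t 0] in a weak sense, although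
    [z_t] is not assumed to be differentiable in [x]: for small [t] the function
    [z_xx t] is close to [t * z_xxt 0], whereas the second differences of [z t]
    are of order [t ^+ 2]. *)
Lemma z_xxt0 x : z_xxt 0 x = 0.
Proof.
have L00 : 0 <= (0 : R) <= L by rewrite lexx ltW.
have [C1 C10 h1] := strip_bounded (`|x| + 1) z_tt_cts.
have [C2 C20 h2] := strip_bounded (`|x| + 1) z_xxtt_cts.
pose C := C1 + C2 + 1; have C0 : 0 < C by rewrite /C; lra.
pose w := z_xxt 0.
have xr y : `|y - x| <= 1 -> `|y| <= `|x| + 1.
  by move=> yx; rewrite -(subrK x y); apply: le_trans (ler_normD _ _) _; lra.
have zC t y : 0 <= t <= L -> `|y - x| <= 1 -> `|z t y| <= C * t ^+ 2.
  move=> tL yx; apply: (@taylor_le (z ^~ y) (z_t ^~ y) (z_tt ^~ y)) => // s sL.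
  - exact: z_dt.
  - exact: z_dtt.
  - by apply: le_trans (h1 s y sL (xr y yx)) _; rewrite /C; lra.
have zxxC t y : 0 <= t <= L -> `|y - x| <= 1 ->
    `|z_xx t y - t * w y| <= C * t ^+ 2.
  move=> tL yx; rewrite [t * _]mulrC.
  apply: (@taylor_le (fun t => z_xx t y - w y * t) (fun t => z_xxt t y - w y)
    (fun t => z_xxtt t y - 0)) => //.
  - by move=> s sL; apply: rderivB; [exact: z_dxxt|exact: rderiv_lin].
  - move=> s sL; apply: rderivB; first exact: z_dxxtt.
    by move=> e e0; exists 1 => // r _ _;
      rewrite subrr mul0r subrr normr0 mulr_ge0 // ltW.
  - by move=> s sL; rewrite subr0; apply: le_trans (h2 s y sL (xr y yx)) _;
    rewrite /C; lra.
  - by rewrite z_xx0 mulr0 subrr.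
  - by rewrite subrr.
apply/eqP; rewrite -normr_le0; apply/ler_addgt0Pr => e0 e00; rewrite add0r.
pose e := e0 / 12; have e_gt0 : 0 < e by rewrite /e; lra.
pose t1 := Num.min L (e / C).
have t10 : 0 < t1 by rewrite lt_min L0 divr_gt0.
have t1L : 0 <= t1 <= L by rewrite ltW //= ge_min lexx.
have t1C : C * t1 <= e by rewrite mulrC -ler_pdivlMr // ge_min lexx orbT.
have et1 : 0 < e * t1 by rewrite mulr_gt0.
have [h' h'0 hh'] := strip_unif `|x| z_xx_cts et1.
pose h := Num.min 1 h'; have h0 : 0 < h by rewrite lt_min ltr01.
have hle : h <= 1 /\ h <= h' by rewrite !ge_min !lexx orbT.
have [hle1 hleh'] := hle.
have wx y : `|y - x| <= h -> `|w y - w x| <= 3 * e.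
  move=> yh; have y1 : `|y - x| <= 1 by apply: le_trans hle1.
  have x1 : `|x - x| <= 1 by rewrite subrr normr0.
  rewrite -(ler_pM2l t10) -(normr_pM _ t10) mulrBr.
  have := hh' t1 x y t1L (lexx _) (le_trans yh hleh').
  have := zxxC t1 y t1L y1; have := zxxC t1 x t1L x1.
  have : C * t1 ^+ 2 <= e * t1 by rewrite expr2 mulrA ler_pM2r.
  by rewrite !ler_norml; lra.
(* with [h] fixed, letting [t] go to 0 leaves the multiple of [e] *)
have key t : 0 < t -> t <= t1 -> `|w x| <= 8 * e + 4 * C * t / h ^+ 2.
  move=> t0 tt1; have tL : 0 <= t <= L.
    by rewrite ltW //= (le_trans tt1) //; case/andP: t1L.
  have Ct : C * t ^+ 2 <= e * t.
    by rewrite expr2 mulrA ler_pM2r //; apply: le_trans t1C; rewrite ler_pM2l.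
  have := @diff2_le R (z t) (z_x t) (z_xx t) x h (t * w x) (4 * e * t) (ltW h0)
    (fun y => z_dx y tL) (fun y => z_dxx y tL).
  have hy y : `|y - x| <= h -> `|z_xx t y - t * w x| <= 4 * e * t.
    move=> yh; have := zxxC t y tL (le_trans yh hle1).
    have := wx y yh; rewrite -(ler_pM2l t0) -(normr_pM _ t0) mulrBr.
    by rewrite !ler_norml; lra.
  move=> /(_ hy).
  have : `|diff2 h (z t) x| <= 4 * (C * t ^+ 2).
    have := zC t (x + h) tL; have := zC t (x - h) tL; have := zC t x tL.
    rewrite subrr normr0 ler01 => /(_ isT).
    have -> : x - h - x = - h by ring.
    have -> : x + h - x = h by ring.
    rewrite normrN (gtr0_norm h0) => k1 /(_ hle1) k2 /(_ hle1) k3.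
    by move: k1 k2 k3; rewrite /diff2 !ler_norml; lra.
  have h20 : 0 < h ^+ 2 by rewrite exprn_gt0.
  have th0 : 0 < t * h ^+ 2 by rewrite mulr_gt0.
  move=> k1 k2; rewrite -(ler_pM2l th0) mulrDr.
  have -> : t * h ^+ 2 * (4 * C * t / h ^+ 2) = 4 * (C * t ^+ 2).
    by field; rewrite gt_eqF.
  rewrite -(normr_pM _ th0).
  have -> : t * h ^+ 2 * w x = h ^+ 2 * (t * w x) by ring.
  have -> : h ^+ 2 * (t * w x)
    = diff2 h (z t) x - (diff2 h (z t) x - h ^+ 2 * (t * w x)) by ring.
  by apply: le_trans (ler_normB _ _) _; lra.
have h20 : 0 < h ^+ 2 by rewrite exprn_gt0.
pose t := Num.min t1 (e * h ^+ 2 / C).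
have t0 : 0 < t by rewrite lt_min t10 divr_gt0 // mulr_gt0.
have tt1 : t <= t1 by rewrite ge_min lexx.
have tC : C * t / h ^+ 2 <= e.
  by rewrite ler_pdivrMr // mulrC -ler_pdivlMr // ge_min lexx orbT.
have := key t t0 tt1; rewrite -!mulrA -/w; rewrite -mulrA in tC.
by rewrite /e in tC *; lra.
Qed.

Lemma rderiv_exp D (k mu t : R) :
  rderiv D (fun s => k * expR (mu * s)) t (k * mu * expR (mu * t)).
Proof.
apply: is_derive_rderiv; apply: is_derive_eq.
by rewrite /GRing.scale /=; ring.
Qed.

(** With [h] the double time primitive of [g], the function [y := z + h]
    satisfies [y - y_xx = h] in the sense of second differences, so the maximum
    principle bounds it by [sup h]. *)
Lemma linear_estimate (a mu : R) : 0 < mu -> 0 <= a ->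
    (forall t x, 0 <= t <= L -> `|g t x| <= a * expR (mu * t)) ->
  forall t x, 0 <= t <= L -> `|z t x| <= 2 * (a / mu ^+ 2) * expR (mu * t).
Proof.
move=> mu0 a0 ga.
have L0' := ltW L0.
have L00 : 0 <= (0 : R) <= L by rewrite lexx.
have /choice[q hq] : forall x, exists q : (R -> R) * (R -> R),
    [/\ q.1 0 = 0, q.2 0 = 0,
        forall t, 0 <= t <= L -> rderiv `[0, L] q.1 t (q.2 t) &
        forall t, 0 <= t <= L -> rderiv `[0, L] q.2 t (g t x)].
  move=> x; have [q2 [q20 hq2]] := primitive L0' (g_cts x).
  have [t e tL e0|q1 [q10 hq1]] := @primitive L q2 L0'.
    exact: rderiv_continuous (hq2 t tL) e e0.
  by exists (q1, q2).
pose h t x := (q x).1 t.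
pose m t := a / mu ^+ 2 * expR (mu * t).
have c0 : 0 <= a / mu ^+ 2 by rewrite divr_ge0 ?sqr_ge0.
have hm t x : 0 <= t <= L -> `|h t x| <= m t.
  move=> tL; have [h00 h10 hh1 hh2] := hq x; have /andP[t0 _] := tL.
  suff H s : `|s| <= 1 -> 0 <= m t + s * h t x.
    have := H 1; have := H (- 1); rewrite normrN1 normr1 lexx.
    by move=> /(_ isT) k1 /(_ isT) k2; rewrite ler_norml; lra.
  move=> s1; have sub := itv_sub tL.
  have tL' r : 0 <= r <= t -> 0 <= r <= L.
    by move=> /andP[-> rt] /=; case/andP: tL => _; exact: le_trans.
  apply: (@rderiv2_ge0 R t (fun r => m r + s * h r x)
    (fun r => a / mu ^+ 2 * mu * expR (mu * r) + s * (q x).2 r)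
    (fun r => a / mu ^+ 2 * mu * mu * expR (mu * r) + s * g r x)) => //.
  - move=> r /tL' rL; apply: rderivD; first exact: rderiv_exp.
    by apply: rderivZ; apply: rderivS sub _; exact: hh1.
  - move=> r /tL' rL; apply: rderivD; first exact: rderiv_exp.
    by apply: rderivZ; apply: rderivS sub _; exact: hh2.
  - move=> r /tL' rL; have -> : a / mu ^+ 2 * mu * mu = a by field;
    rewrite gt_eqF.
    have := ga r x rL; have : `|s * g r x| <= `|g r x| by rewrite normrM
      ler_piMl.
    by move=> k1 k2; have := le_trans k1 k2; rewrite ler_norml; lra.
  - by rewrite /h h00 (mulr0 s) addr0 /m mulr_ge0 // expR_ge0.
  - by rewrite h10 (mulr0 s) addr0 mulr_ge0 ?expR_ge0 // mulr_ge0 // ltW.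
have approx t : 0 <= t <= L -> forall r e : R, 0 < e ->
    exists2 d, 0 < d & forall x, `|x| <= r ->
    `|diff2 d (fun x => z t x + h t x) x - d ^+ 2 * z t x| <= e * d ^+ 2.
  move=> tL r e e0; have /andP[t0 tL'] := tL.
  have b0 : 0 < 2 * (1 + L ^+ 2) by have := sqr_ge0 L; lra.
  pose k := e / (2 * (1 + L ^+ 2)); have k0 : 0 < k by rewrite divr_gt0.
  have kE : k * (2 * (1 + L ^+ 2)) = e by rewrite /k divfK // gt_eqF.
  have [d1 d10 hd1] := strip_unif r z_xx_cts k0.
  have [d2 d20 hd2] := strip_unif r g_xx_cts k0.
  pose d := Num.min d1 d2; have d0 : 0 < d by rewrite lt_min d10.
  have [dd1 dd2] : d <= d1 /\ d <= d2 by rewrite !ge_min !lexx orbT.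
  exists d => // x xr.
  have Z : `|diff2 d (z t) x - d ^+ 2 * z_xx t x| <= 2 * k * d ^+ 2.
    apply: (diff2_le (ltW d0) (fun y => z_dx y tL) (fun y =>
      z_dxx y tL)) => y yd.
    exact: hd1 (le_trans yd dd1).
  have [p00 p10 hp1 hp2] := hq (x + d); have [m00 m10 hm1 hm2] := hq (x - d).
  have [c00 c10 hc1 hc2] := hq x.
  have H : `|diff2 d (h t) x - d ^+ 2 * (z t x - z_xx t x)|
      <= 2 * k * d ^+ 2 * t ^+ 2.
    apply: (@taylor_le (fun s => diff2 d (h s) x - d ^+ 2 * (z s x - z_xx s x))
      (fun s => (q (x + d)).2 s + (q (x - d)).2 s - 2 * (q x).2 s
         - d ^+ 2 * (z_t s x - z_xxt s x))
      (fun s => diff2 d (g s) x - d ^+ 2 * (z_tt s x - z_xxtt s x))) => //.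
    - move=> s sL; rewrite /diff2 /h; apply: rderivB; last first.
        by apply: rderivZ; apply: rderivB; [exact: z_dt|exact: z_dxxt].
      apply: rderivB; last by apply: rderivZ; exact: hc1.
      by apply: rderivD; [exact: hp1|exact: hm1].
    - move=> s sL; rewrite /diff2 /h; apply: rderivB; last first.
        by apply: rderivZ; apply: rderivB; [exact: z_dtt|exact: z_dxxtt].
      apply: rderivB; last by apply: rderivZ; exact: hc2.
      by apply: rderivD; [exact: hp2|exact: hm2].
    - move=> s sL; rewrite equation //.
      apply: (diff2_le (ltW d0) (fun y => g_dx y sL) (fun y =>
        g_dxx y sL)) => y yd.
      exact: hd2 (le_trans yd dd2).
    - by rewrite /diff2 /h p00 m00 c00 z0 z_xx0; ring.
    - by rewrite p10 m10 c10 z_t0 z_xxt0; ring.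
  have -> : diff2 d (fun x => z t x + h t x) x - d ^+ 2 * z t x
    = (diff2 d (z t) x - d ^+ 2 * z_xx t x)
      + (diff2 d (h t) x - d ^+ 2 * (z t x - z_xx t x)) by rewrite /diff2; ring.
  apply: le_trans (ler_normD _ _) _.
  have t2 : t ^+ 2 <= L ^+ 2 by rewrite lerXn2r ?nnegrE //; lra.
  have d20' : 0 <= 2 * k * d ^+ 2 by rewrite mulr_ge0 ?sqr_ge0 // mulr_ge0 //
    ltW.
  have := ler_wpM2l d20' t2.
  have -> : e * d ^+ 2 = 2 * k * d ^+ 2 + 2 * k * d ^+ 2 * L ^+ 2.
    by rewrite -kE; ring.
  by lra.
move=> t x tL.
have yK u : `|z t u + h t u| <= K + m t.
  by apply: le_trans (ler_normD _ _) _;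
    exact: lerD (z_bounded u tL) (hm t u tL).
have up : z t x + h t x <= m t.
  apply: (@max_principle R (fun x => z t x + h t x) (h t) (K + m t)) => //.
    by move=> u; have := hm t u tL; rewrite ler_norml => /andP[].
  move=> r e e0; have [d d0 hd] := approx t tL r e e0; exists d => // u ur.
  by rewrite addrK; exact: hd.
have dn : - (z t x + h t x) <= m t.
  apply: (@max_principle R (fun x => - (z t x + h t x)) (fun u =>
    - h t u) (K + m t)).
  - by move=> u; rewrite normrN.
  - by move=> u; have := hm t u tL; rewrite ler_norml; lra.
  - move=> r e e0; have [d d0 hd] := approx t tL r e e0; exists d => // u ur.
    rewrite -normrN; apply: le_trans (hd u ur).
    by rewrite le_eqVlt; apply/orP; left; apply/eqP; congr `|_|;
      rewrite /diff2; ring.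
have := hm t x tL; rewrite -(mulrA 2) -/(m t) !ler_norml; lra.
Qed.

End linear.

End real_estimate.

(** * Uniqueness *)

(** The maximum principle is real-valued, so complex data are used through their
    real and imaginary parts; [pr] stands for either. *)
Section projections.
Variables (R : realType) (pr : R[i] -> R).
Hypothesis prB : forall z w, pr (z - w) = pr z - pr w.
Hypothesis prZ : forall z (r : R), pr (z * (r%:C)%C) = pr z * r.
Hypothesis pr_le : forall z, `|pr z| <= normc z.

Lemma rderiv_proj (D : set R) (f : R -> R[i]) a l :
  has_deriv_within D f a l -> rderiv D (fun s => pr (f s)) a (pr l).
Proof.
move=> /has_deriv_withinP h e e0; have [d d0 hd] := h e e0.
by exists d => // s Ds sa; rewrite -prZ -!prB (le_trans (pr_le _)) // hd.
Qed.

Lemma strip_cts_proj L (f : R -> R -> R[i]) :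
  strip_continuous L f -> strip_cts L (fun t x => pr (f t x)).
Proof.
move=> /strip_continuousP h t x e tL e0; have [d d0 hd] := h t x e tL e0.
by exists d => // t' x' k1 k2 k3; rewrite -prB (le_lt_trans (pr_le _)) // hd.
Qed.

End projections.

Section complex_derivatives.
Variable R : realType.

Lemma has_deriv_withinD (D : set R) (f g : R -> R[i]) a l m :
  has_deriv_within D f a l -> has_deriv_within D g a m ->
  has_deriv_within D (fun s => f s + g s) a (l + m).
Proof.
move=> /has_deriv_withinP hf /has_deriv_withinP hg;
  apply/has_deriv_withinP => e e0.
have e20 : 0 < e / 2 by lra.
have [d1 d10 h1] := hf _ e20; have [d2 d20 h2] := hg _ e20.
exists (Num.min d1 d2) => [|s Ds]; first by rewrite lt_min d10.
rewrite lt_min => /andP[/(h1 _ Ds) k1 /(h2 _ Ds) k2].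
have -> : f s + g s - (f a + g a) - (l + m) * ((s - a)%:C)%C =
  (f s - f a - l * ((s - a)%:C)%C) + (g s - g a - m * ((s - a)%:C)%C) by ring.
by apply: le_trans (normcD _ _) _; lra.
Qed.

Lemma has_deriv_withinN (D : set R) (f : R -> R[i]) a l :
  has_deriv_within D f a l -> has_deriv_within D (fun s => - f s) a (- l).
Proof.
move=> /has_deriv_withinP hf; apply/has_deriv_withinP => e e0.
have [d d0 h] := hf _ e0; exists d => // s Ds sa.
have -> : - f s - - f a - - l * ((s - a)%:C)%C
  = - (f s - f a - l * ((s - a)%:C)%C) by ring.
by rewrite normc_opp h.
Qed.

Lemma has_deriv_withinB (D : set R) (f g : R -> R[i]) a l m :
  has_deriv_within D f a l -> has_deriv_within D g a m ->
  has_deriv_within D (fun s => f s - g s) a (l - m).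
Proof. by move=> hf /has_deriv_withinN; exact: has_deriv_withinD. Qed.

Lemma has_deriv_within_continuous (D : set R) (f : R -> R[i]) a l :
  has_deriv_within D f a l -> forall e : R, 0 < e -> exists2 d : R, 0 < d &
    forall s, D s -> `|s - a| < d -> normc (f s - f a) < e.
Proof.
move=> /has_deriv_withinP /(_ 1 ltr01) [d d0 h] e e0; have l0 := normc_ge0 l.
have l1 : 0 < normc l + 1 by lra.
exists (Num.min d (e / (normc l + 1))) => [|s Ds].
  by rewrite lt_min d0 divr_gt0.
rewrite lt_min ltr_pdivlMr // mulrDr mulr1 => /andP[/(h _ Ds) k1 k2].
have -> : f s - f a = (f s - f a - l * ((s - a)%:C)%C) + l * ((s - a)%:C)%C by
  ring.
apply: le_lt_trans (normcD _ _) _; rewrite normcM normc_real.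
by apply: le_lt_trans k2; rewrite mul1r mulrC in k1 *; lra.
Qed.

Lemma strip_continuousD L (f g : R -> R -> R[i]) :
  strip_continuous L f -> strip_continuous L g ->
  strip_continuous L (fun t x => f t x + g t x).
Proof.
move=> /strip_continuousP hf /strip_continuousP hg.
apply/strip_continuousP => t x e tL e0; have e20 : 0 < e / 2 by lra.
have [d1 d10 h1] := hf t x _ tL e20; have [d2 d20 h2] := hg t x _ tL e20.
exists (Num.min d1 d2) => [|s y sL]; first by rewrite lt_min d10.
rewrite !lt_min => /andP[a1 a2] /andP[b1 b2].
have := h1 s y sL a1 b1; have := h2 s y sL a2 b2.
have -> : f s y + g s y - (f t x + g t x)
  = (f s y - f t x) + (g s y - g t x) by ring.
by move=> k1 k2; apply: le_lt_trans (normcD _ _) _; lra.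
Qed.

Lemma strip_continuousB L (f g : R -> R -> R[i]) :
  strip_continuous L f -> strip_continuous L g ->
  strip_continuous L (fun t x => f t x - g t x).
Proof.
move=> hf /strip_continuousP hg.
have hN : strip_continuous L (fun t x => - g t x).
  apply/strip_continuousP => t x e tL e0.
  have [d d0 h] := hg t x e tL e0; exists d => // s y sL a b.
  have -> : - g s y - - g t x = - (g s y - g t x) by ring.
  by rewrite normc_opp h.
exact: strip_continuousD hf hN.
Qed.

Lemma normc_pow_lip (K : R) (v w : R[i]) n : 1 <= K ->
    normc v <= K -> normc w <= K ->
  normc (v ^+ n - w ^+ n) <= n%:R * K ^+ n * normc (v - w).
Proof.
move=> K1 vK wK; have K0 : 0 <= K by lra.
elim: n => [|n IH]; first by rewrite !expr0 subrr normc0 !mul0r.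
have -> : v ^+ n.+1 - w ^+ n.+1 = v * (v ^+ n - w ^+ n) + w ^+ n * (v - w).
  by rewrite !exprS; ring.
apply: le_trans (normcD _ _) _; rewrite !normcM normcX.
have h1 : normc v * normc (v ^+ n - w ^+ n)
    <= K * (n%:R * K ^+ n * normc (v - w)).
  by apply: ler_pM; rewrite ?normc_ge0.
have h2 : normc w ^+ n * normc (v - w) <= K ^+ n.+1 * normc (v - w).
  rewrite ler_wpM2r ?normc_ge0 //; apply: (@le_trans _ _ (K ^+ n)).
    by rewrite lerXn2r ?nnegrE ?normc_ge0.
  by rewrite ler_weXn2l.
have -> : n.+1%:R * K ^+ n.+1 * normc (v - w)
  = K * (n%:R * K ^+ n * normc (v - w)) + K ^+ n.+1 * normc (v - w).
  by rewrite -natr1 exprS; ring.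
exact: lerD.
Qed.

Lemma le_halves_0 (y X : R) : (forall n, y <= X / 2 ^+ n) -> y <= 0.
Proof.
move=> h; rewrite leNgt; apply/negP => y0.
have X0 : 0 < X by have := h 0%N; rewrite expr0; lra.
have [n hn] : exists n : nat, X / y < n%:R.
  by exists (Num.bound (X / y)); apply: archi_boundP; rewrite divr_ge0 // ltW.
have n2 : n%:R <= 2 ^+ n :> R by rewrite -natrX ler_nat ltnW // ltn_expl.
have := h n; rewrite ler_pdivlMr ?exprn_gt0 // => k.
move: hn; rewrite ltr_pdivrMr // => hn.
by have := ler_wpM2r (ltW y0) n2; rewrite mulrC in hn *; lra.
Qed.

End complex_derivatives.

Section uniqueness.
Variables (R : realType) (nu p : nat) (omega : 'rV[R]_nu).
Variables (c d : 'rV[int]_nu -> R[i]) (L B rho : R).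
Hypotheses (L0 : 0 < L) (B0 : 0 <= B) (rho01 : 0 < rho <= 1).

Lemma qp_bounded (f : 'rV[int]_nu -> R[i]) x s :
  exp_decay B (rho / 2) f -> qp_sum omega f x s ->
    normc s <= B * b_const nu rho.
Proof.
move=> /exp_decayP hf /has_sum_normc; apply.
apply: sum_leW (sum_leZ B0 (sum_le_lattice rho01)) => n.
by rewrite normcM normc_expi mulr1.
Qed.

Lemma solution_unique u uhat v vhat :
    classical_qp_solution p omega c d L u uhat ->
    (forall t, 0 <= t <= L -> exp_decay B (rho / 2) (uhat t)) ->
    classical_qp_solution p omega c d L v vhat ->
    (forall t, 0 <= t <= L -> exp_decay B (rho / 2) (vhat t)) ->
  forall t x, 0 <= t <= L -> v t x = u t x.
Proof.
move=> [uq [u_t [u_tt [u_x [u_xx [u_xxt [u_xxtt [up_x [up_xx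
  [[[du1 du2] [du3 du4] [du5 du6] [du7 du8]]
   [[cu1 cu2 cu3 cu4 cu5] [equ iu ju]]]]]]]]]]]] udec.
move=> [vq [v_t [v_tt [v_x [v_xx [v_xxt [v_xxtt [vp_x [vp_xx
  [[[dv1 dv2] [dv3 dv4] [dv5 dv6] [dv7 dv8]]
   [[cv1 cv2 cv3 cv4 cv5] [eqv iv jv]]]]]]]]]]]] vdec.
pose K := B * b_const nu rho + 1.
have b0 : 0 <= b_const nu rho := sum_le_ge0 (sum_le_lattice rho01).
have K1 : 1 <= K by rewrite /K lerDr mulr_ge0.
have uK t x : 0 <= t <= L -> normc (u t x) <= K.
  by move=> tL; have := qp_bounded (udec t tL) (uq t x tL); rewrite /K; lra.
have vK t x : 0 <= t <= L -> normc (v t x) <= K.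
  by move=> tL; have := qp_bounded (vdec t tL) (vq t x tL); rewrite /K; lra.
pose z t x := v t x - u t x.
pose g t x := z t x + (v t x ^+ p - u t x ^+ p).
pose C := 1 + p%:R * K ^+ p.
have C1 : 1 <= C by rewrite /C lerDl mulr_ge0 // exprn_ge0 // (le_trans ler01).
have gz t x : 0 <= t <= L -> normc (g t x) <= C * normc (z t x).
  move=> tL; apply: le_trans (normcD _ _) _; rewrite mulrDl mul1r lerD2l.
  by apply: normc_pow_lip; [|exact: vK|exact: uK].
have g_cts x t e : 0 <= t <= L -> 0 < e -> exists2 d : R, 0 < d &
    forall s, 0 <= s <= L -> `|s - t| < d -> normc (g s x - g t x) < e.
  move=> tL e0; have e1 : 0 < e / (2 * C) by rewrite divr_gt0 // mulr_gt0 //;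
    lra.
  have [d1 d10 h1] := has_deriv_within_continuous (dv1 t x tL) e1.
  have [d2 d20 h2] := has_deriv_within_continuous (du1 t x tL) e1.
  exists (Num.min d1 d2) => [|s sL]; first by rewrite lt_min d10.
  have sI : `[0, L]%classic s by rewrite /= in_itv.
  rewrite lt_min => /andP[/(h1 s sI) k1 /(h2 s sI) k2].
  have -> : g s x - g t x = (v s x - v t x + (v s x ^+ p - v t x ^+ p))
    - (u s x - u t x + (u s x ^+ p - u t x ^+ p)) by rewrite /g /z; ring.
  have l1 : normc (v s x - v t x + (v s x ^+ p - v t x ^+ p))
      <= C * normc (v s x - v t x).
    apply: le_trans (normcD _ _) _; rewrite mulrDl mul1r lerD2l.
    by apply: normc_pow_lip; rewrite ?vK.
  have l2 : normc (u s x - u t x + (u s x ^+ p - u t x ^+ p))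
      <= C * normc (u s x - u t x).
    apply: le_trans (normcD _ _) _; rewrite mulrDl mul1r lerD2l.
    by apply: normc_pow_lip; rewrite ?uK.
  apply: le_lt_trans (normcB _ _) _.
  have C0 : 0 < C by lra.
  have C20 : 0 < 2 * C by lra.
  move: k1 k2; rewrite !ltr_pdivlMr // => k1 k2; lra.
pose mu := 1 + 8 * C; have mu0 : 0 < mu by rewrite /mu; lra.
have proj (pr : R[i] -> R) S :
    (forall z w, pr (z - w) = pr z - pr w) ->
    (forall z (r : R), pr (z * (r%:C)%C) = pr z * r) ->
    (forall z, `|pr z| <= normc z) -> 0 <= S ->
    (forall t x, 0 <= t <= L -> normc (z t x) <= S * expR (mu * t)) ->
  forall t x, 0 <= t <= L ->
    `|pr (z t x)| <= 2 * (C * S / mu ^+ 2) * expR (mu * t).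
  move=> prB prZ pr_le S0 zS.
  have dB D f h y l m (hf : has_deriv_within D f y l)
      (hh : has_deriv_within D h y m) :=
    rderiv_proj prB prZ pr_le (has_deriv_withinB hf hh).
  have dD D f h y l m (hf : has_deriv_within D f y l)
      (hh : has_deriv_within D h y m) :=
    rderiv_proj prB prZ pr_le (has_deriv_withinD hf hh).
  have pr0 : pr 0 = 0 by rewrite -(subrr 0) prB subrr.
  apply: (@linear_estimate R L (K + K) L0
    (fun t x => pr (z t x)) (fun t x => pr (v_x t x - u_x t x))
    (fun t x => pr (v_xx t x - u_xx t x)) (fun t x => pr (v_t t x - u_t t x))
    (fun t x => pr (v_tt t x - u_tt t x)) (fun t x =>
      pr (v_xxt t x - u_xxt t x))
    (fun t x => pr (v_xxtt t x - u_xxtt t x)) (fun t x => pr (g t x))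
    (fun t x => pr (v_x t x - u_x t x + (vp_x t x - up_x t x)))
    (fun t x => pr (v_xx t x - u_xx t x + (vp_xx t x - up_xx t x)))) => //.
  - by move=> t x tL; apply: dB; [exact: dv1|exact: du1].
  - by move=> t x tL; apply: dB; [exact: dv2|exact: du2].
  - by move=> t x tL; apply: dB; [exact: dv3|exact: du3].
  - by move=> t x tL; apply: dB; [exact: dv4|exact: du4].
  - by move=> t x tL; apply: dB; [exact: dv5|exact: du5].
  - by move=> t x tL; apply: dB; [exact: dv6|exact: du6].
  - by move=> t x tL; apply: dD; apply: has_deriv_withinB;
      [exact: dv3|exact: du3|exact: dv7|exact: du7].
  - by move=> t x tL; apply: dD; apply: has_deriv_withinB;
      [exact: dv4|exact: du4|exact: dv8|exact: du8].
  - exact (strip_cts_proj prB pr_le (strip_continuousB cv2 cu2)).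
  - exact (strip_cts_proj prB pr_le (strip_continuousB cv3 cu3)).
  - exact (strip_cts_proj prB pr_le (strip_continuousB cv4 cu4)).
  - exact (strip_cts_proj prB pr_le (strip_continuousD
      (strip_continuousB cv3 cu3) (strip_continuousB cv5 cu5))).
  - move=> x t e tL e0; have [d1 d10 h1] := g_cts x t e tL e0.
    exists d1 => // s sL st; rewrite -prB; apply: le_lt_trans (pr_le _) _.
    exact: h1.
  - move=> t x tL; apply: le_trans (pr_le _) _; apply: le_trans (normcB _ _) _.
    by apply: lerD; [exact: vK|exact: uK].
  - by move=> x; rewrite /z (has_sum_unique (iv x) (iu x)) subrr pr0.
  - by move=> x; rewrite (has_sum_unique (jv x) (ju x)) subrr pr0.
  - move=> t x tL; rewrite -prB; congr pr; apply/eqP; rewrite -subr_eq0;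
    apply/eqP.
    transitivity ((v_tt t x - v_xx t x - v_xxtt t x - vp_xx t x)
      - (u_tt t x - u_xx t x - u_xxtt t x - up_xx t x)); first by ring.
    by rewrite equ // eqv // subrr.
  - by rewrite mulr_ge0 //; lra.
  - move=> t x tL; apply: le_trans (pr_le _) _; apply: le_trans (gz t x tL) _.
    by rewrite -mulrA ler_wpM2l ?zS //; lra.
have half S : 0 <= S ->
    (forall t x, 0 <= t <= L -> normc (z t x) <= S * expR (mu * t)) ->
    (forall t x, 0 <= t <= L -> normc (z t x) <= S / 2 * expR (mu * t)).
  move=> S0 zS t x tL; apply: le_trans (normc_le_ReIm _) _.
  have h1 : `|complex.Re (z t x)| <= 2 * (C * S / mu ^+ 2) * expR (mu * t).
    apply: (proj (@complex.Re R)) => //.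
    - by move=> [a1 b1] [a2 b2].
    - by move=> [a1 b1] r /=; rewrite mulr0 subr0.
    - exact: Re_le_normc.
  have h2 : `|complex.Im (z t x)| <= 2 * (C * S / mu ^+ 2) * expR (mu * t).
    apply: (proj (@complex.Im R)) => //.
    - by move=> [a1 b1] [a2 b2].
    - by move=> [a1 b1] r /=; rewrite mulr0 add0r.
    - exact: Im_le_normc.
  apply: le_trans (lerD h1 h2) _; rewrite -mulrDl ler_wpM2r ?expR_ge0 //.
  (* the two parts together lose a factor 4, hence the 8 in [mu] *)
  have mu2 : 8 * C <= mu ^+ 2 by rewrite /mu; nra.
  have mu20 : 0 < mu ^+ 2 by rewrite exprn_gt0.
  have : C * S / mu ^+ 2 <= S / 8.
    rewrite ler_pdivrMr // mulrC -mulrA ler_wpM2l //; lra.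
  by lra.
have iter n : forall t x, 0 <= t <= L ->
    normc (z t x) <= (K + K) / 2 ^+ n * expR (mu * t).
  elim: n => [|n IH] t x tL.
    rewrite expr0 divr1; apply: (@le_trans _ _ (K + K)).
      by apply: le_trans (normcB _ _) _; apply: lerD; [exact: vK|exact: uK].
    rewrite ler_peMr //; first by lra.
    by rewrite -expR0 ler_expR mulr_ge0 //; [exact: ltW|case/andP: tL].
  rewrite exprSr invfM mulrA; apply: half IH t x tL.
  by rewrite divr_ge0 ?exprn_ge0 //; lra.
move=> t x tL; apply/eqP; rewrite -subr_eq0 -/(z t x); apply/eqP/eq0_normc/eqP.
rewrite eq_le normc_ge0 andbT;
  apply: (@le_halves_0 R _ ((K + K) * expR (mu * t))).
by move=> n; rewrite mulrAC; exact: iter.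
Qed.

End uniqueness.

(** * The Cauchy problem *)

Theorem theorem4p1 (R : realType) (nu p : nat) (hnu : (2 <= nu)%N)
    (hp : (3 <= p)%N) (omega : 'rV[R]_nu) (homega : nonresonant omega)
    (c d : 'rV[int]_nu -> R[i]) (A rho : R) (hA : 0 < A) (hrho0 : 0 < rho)
    (hrho1 : rho <= 1) (hc : exp_decay A rho c) (hd : exp_decay A rho d) :
  let L := L_const nu p A rho in
  let B := B_const nu A rho in
  exists (u : R -> R -> R[i]) (uhat : R -> 'rV[int]_nu -> R[i]),
    [/\ classical_qp_solution p omega c d L u uhat,
        forall t : R, 0 <= t <= L -> exp_decay B (rho / 2%:R) (uhat t) &
        forall (v : R -> R -> R[i]) (vhat : R -> 'rV[int]_nu -> R[i]),
          classical_qp_solution p omega c d L v vhat ->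
          (forall t : R, 0 <= t <= L -> exp_decay B (rho / 2%:R) (vhat t)) ->
          forall t x : R, 0 <= t <= L -> v t x = u t x].
Proof.
move=> L B.
have L0 : 0 < L := L_gt0 nu hp A rho.
have B0 : 0 <= B by rewrite mulr_ge0 // (le_trans ler01) // M_ge1.
have rho01 : 0 < rho <= 1 by rewrite hrho0.
have sol_cl := sol_classical omega hp hA hrho0 hrho1 hc hd.
have sol_dec := sol_hat_decay omega hp hA hrho0 hrho1 hc hd.
exists (sol p omega c d), (sol_hat p omega c d); split=> // v vhat vcl vdec.
move=> t x tL; exact: (solution_unique L0 B0 rho01 sol_cl sol_dec vcl vdec x
  tL).
Qed.
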